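(* For all integers $r,\ell$ in the ranges indicated, the restricted weights of the codes $C_{symm}(t,m)$ are given by the following formulas. (1) If $r,\ell\ge0$, $2r+1\le m$ and $2\ell+1\le m$: $$\mathrm{w}_{2\ell+1}(2r+1,m)=\frac{q-1}{q}\left(\mu_{2r+1}(m)+q^{2r}F_r^{(m-1)}(\ell)\right).$$ (2) If $r\ge0$, $\ell\ge1$, $2r+1\le m$, $2\ell\le m$ and $\tau\in\{1,-1\}$: $$\mathrm{w}_{2\ell}^{\tau}(2r+1,m)=\frac{q-1}{q}\left(\mu_{2r+1}(m)+q^{2r}F_r^{(m-1)}(\ell-1)-\tau q^{m-\ell+2r}F_r^{(m-2)}(\ell-1)\right).$$ (3) If $r,\ell\ge0$, $2r\le m$ and $2\ell+1\le m$: $$\mathrm{w}_{2\ell+1}(2r,m)=\frac{q-1}{q}\left(\mu_{2r}(m)-q^{2r}F_r^{(m-1)}(\ell)\right).$$ (4) If $r\ge0$, $\ell\ge1$, $2r\le m$, $2\ell\le m$ and $\tau\in\{1,-1\}$: $$\mathrm{w}_{2\ell}^{\tau}(2r,m)=\frac{q-1}{q}\left(\mu_{2r}(m)-q^{2r}F_r^{(m-1)}(\ell-1)+\tau q^{m-\ell+2r-2}F_{r-1}^{(m-2)}(\ell-1)\right).$$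
   Context: $m$ is a positive integer, $q$ is a power of an odd prime, $\mathbb{F}_q$ is the finite field with $q$ elements, and $\mathbb{X}$ is the space of $m\times m$ symmetric matrices over $\mathbb{F}_q$. For $0\le r\le m$, $\mathbb{X}_r=\{A\in\mathbb{X}:\operatorname{rank}(A)=r\}$ and $\mu_m(r)=\mu_r(m)=|\mathbb{X}_r|$. For $0\le t\le m$ write $\{A\in\mathbb{X}:\operatorname{rank}(A)\le t\}=\{A_1,\dots,A_N\}$; the code $C_{symm}(t,m)\subseteq\mathbb{F}_q^N$ consists of the codewords $c_B=(\mathrm{Tr}(BA_1),\dots,\mathrm{Tr}(BA_N))$, $B\in\mathbb{X}$. Types: a symmetric matrix of odd rank has type $0$. A symmetric matrix of even rank $2s$ has type $1$ (hyperbolic) if the nondegenerate quadratic form it induces modulo its radical is hyperbolic (an orthogonal sum of $s$ hyperbolic planes), and type $-1$ (elliptic) otherwise. Restricted weights: for $B\in\mathbb{X}$ of rank $k$ and type $\tau$, $\mathrm{w}_k^{\tau}(r,m)=|\{A\in\mathbb{X}_r:\mathrm{Tr}(BA)\neq0\}|$; this depends only on $k,\tau$ (and $r,m,q$), not on $B$. When $k$ is odd, $\tau$ is omitted. Generalized Krawtchouk polynomials: for an integer $M\ge0$ put $n=\lfloor M/2\rfloor$, and for $0\le s\le n$ let $\Omega_s$ be the set of $M\times M$ skew-symmetric matrices over $\mathbb{F}_q$ of rank $2s$. Fix a nontrivial character $\chi$ of $(\mathbb{F}_q,+)$. For $0\le s\le n$ and any $A=(a_{ij})\in\Omega_s$,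 $$F_r^{(M)}(s)=\sum_{B=(b_{ij})\in\Omega_r}\chi\Big(\sum_{i<j}a_{ij}b_{ij}\Big),$$ which is independent of the choices of $A$ and $\chi$; $F_r^{(M)}(s)=0$ if $r<0$ or $r>n$. (It is known that for $n\ge1$ and $0\le r\le n$, $F_r^{(M)}(s)=\sum_{j=0}^r(-1)^{r-j}q^{(r-j)(r-j-1)}\left[{n-j\atop n-r}\right]\left[{n-s\atop j}\right]c^j$ with $c=q^{M(M-1)/(2n)}$ and $\left[{a\atop k}\right]=\prod_{i=0}^{k-1}\frac{q^{2a}-q^{2i}}{q^{2k}-q^{2i}}$.) *)

(* Defs.v *)
From HB Require Import structures.
From mathcomp Require Import all_boot all_order all_algebra all_fingroup all_field.
From mathcomp Require Import all_character.

Set Implicit Arguments.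
Unset Strict Implicit.
Unset Printing Implicit Defensive.

Import GRing.Theory.
Local Open Scope ring_scope.

Section Definitions.
Variable F : finFieldType.

Definition symrk (m r : nat) : {set 'M[F]_m} :=
  [set A : 'M[F]_m | (A^T == A) && (\rank A == r)].

Definition musym (m r : nat) : nat := #|symrk m r|.

Section Type_of_symmetric_matrix.
Variable m : nat.
Implicit Type B : 'M[F]_m.

Definition qform B (x : 'rV[F]_m) : F := (x *m B *m x^T) 0 0.

(* The radical of the form of a symmetric B is its kernel {x | x B = 0}.
   The rows of E and G are representatives of a basis
   e_0, ..., e_(s-1), g_0, ..., g_(s-1) of 'rV_m / rad: they span modulo the
   radical, and their number is 2s = \rank B = m - dim rad (the only case in
   which mxtype uses this definition).  In the coordinates of that basis the
   induced form is \sum_i u_i v_i, so that <e_i, g_i> is a hyperbolic plane and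
   the s planes are pairwise orthogonal. *)
Definition hyperbolic B : bool :=
  let s := (\rank B)./2 in
  [exists E : 'M[F]_(s, m), exists G : 'M[F]_(s, m),
    (E + G + kermx B == 1%:M)%MS &&
    [forall u : 'rV[F]_s, forall v : 'rV[F]_s,
       qform B (u *m E + v *m G) == \sum_i u 0 i * v 0 i]].

Definition mxtype B : int :=
  if odd (\rank B) then 0 else if hyperbolic B then 1 else -1.

(* For B of rank k and type tau this is w_k^tau(r, m). *)
Definition rweight B (r : nat) : nat :=
  #|[set A in symrk m r | \tr (B *m A) != 0]|.

End Type_of_symmetric_matrix.

Definition skewrk (M s : nat) : {set 'M[F]_M} :=
  [set A : 'M[F]_M | (A^T == - A) && (\rank A == s.*2)].

(* chi is meant to be a nontrivial linear character of the group [set: F],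
   whose group law is the addition of F.  The sum takes the same value at
   every A in skewrk M s, a set that is nonempty for s <= M./2; pick selects
   an arbitrary element of it. *)
Definition krawtchouk (chi : 'CF([set: F])) (M : nat) (r : int) (s : nat)
    : algC :=
  match r with
  | Posz k =>
      if (k <= M./2)%N then
        if [pick A in skewrk M s] is Some A then
          \sum_(B in skewrk M k)
            chi (\sum_(i < M) \sum_(j < M | (i < j)%N) A i j * B i j)
        else 0
      else 0
  | Negz _ => 0
  end.

End Definitions.

(* Main.v *)
Require Import Defs.
From HB Require Import structures.
From mathcomp Require Import all_boot all_order all_algebra all_fingroup all_field.
From mathcomp Require Import all_character.
From mathcomp Require Import ring zify.

Set Implicit Arguments.
Unset Strict Implicit.
Unset Printing Implicit Defensive.

Import GRing.Theory.
Local Open Scope ring_scope.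

(** A weight is a character sum in disguise.  Matrices of rank [r] are stable
    under scaling by nonzero [c], so summing [chi (c * \tr (B *m A))] over all
    [c] gives [weight_charsum]: with [S_r(B)] the sum of [chi (\tr (B *m A))]
    over symmetric [A] of rank [r], the weight is [(q - 1) / q] times the number
    of such [A] minus [S_r(B)].  The theorem thus expresses [S_r(B)] by sums of
    the same shape over skew-symmetric matrices.

    Symmetric and skew-symmetric matrices are treated together, as the solutions
    of [A^T = eps *: A] with [eps = 1] or [eps = -1].  The sums for all ranks are
    packed in one function (genfun)

      Z_B(z) = \sum_A chi (\tr (B *m A^T)) * z ^+ \rank A.

    Cutting off the first row and column of [A] and summing over them gives
    recursions in [B] (genfun_zero, genfun_hyp), where [c] is the number of
    scalars with [a = eps * a], [H] is a hyperbolic plane and [B] has size [n]: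

      Z_(0+B)(z) = (1 + (c-1) z - c z^2) Z_B(q z) + c q^n z^2 Z_B(z),
      Z_(H+B)(z) = (1 + (c-1) z - c z^2) Z_B(q z).

    The quadratic factor is [1 - z^2] for skew-symmetric matrices ([c = 1]) and
    [(1 - z)(1 + q z)] for symmetric ones ([c = q]).  Since
    [(1 - z)(1 + q z)(1 - q z) = (1 - z)(1 - (q z)^2)], whenever [Phi] follows
    the skew recursions, [(1 - z) Phi(q z)] follows the symmetric ones with one
    more row and column, and [(1 - z) z Phi(q z)] does so with two more, up to a
    power of [q].  So it remains to match initial values.  Over a finite field
    of odd characteristic, every symmetric form is reduced, by removing radical
    lines and hyperbolic planes, to an anisotropic form of dimension at most 2
    (genfun_scalar, genfun_anisotropic), except that a hyperbolic form is reduced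
    to a zero form, where rank distributions have to be compared
    (rankgf_sym_skew).  This yields, for [B] of rank [2l + 1] ([tau = 0]) or
    [2l + 2] ([tau] the type),

      Z_B(z) = (1 - z) (Phi_(m-1,l)(q z) + tau q^(m-l-1) z Phi_(m-2,l)(q z)),

    where [Phi_(M,l)] is the function of any skew-symmetric matrix of size [M]
    and rank [2l] (genfun_skew, genfun_hyperbolic, genfun_nonhyperbolic).  As
    [Phi] is even, comparing the coefficients of [z^(2r)] and [z^(2r+1)] gives
    the formulas (charsum_sym).

    No cancellation theorem for quadratic forms is used.  A hyperbolic form is
    split along a given hyperbolic frame, and what is left is hyperbolic by
    construction; a form that is not hyperbolic is split arbitrarily, and what
    is left cannot be hyperbolic, since a frame of it would extend. *)

(** * Sums of an additive character over linear spaces *)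

Section AdditiveCharacter.
Variables (F : finFieldType) (psi : F -> algC).
Let q : algC := #|F|%:R.
Hypothesis psiD : {morph psi : x y / x + y >-> x * y}.
Hypothesis psi0 : psi 0 = 1.
Hypothesis psi_nontrivial : exists y, psi y != 1.

(** Orthogonality of characters: translation by a vector at which the character
    is not 1 multiplies the sum by a factor different from 1. *)
Lemma sum_char_linear k (c : 'cV[F]_k) :
  \sum_(t : 'rV_k) psi ((t *m c) 0 0) = if c == 0 then q ^+ k else 0.
Proof.
case: eqVneq => [-> | c_neq0].
  under eq_bigr => t _ do rewrite mulmx0 mxE psi0.
  by rewrite sumr_const card_mx mul1n natrX.
have [i ci] : exists i, c i 0 != 0.
  apply/existsP; apply: contraNT c_neq0; rewrite negb_exists => /forallP H.
  by apply/eqP/colP => i; rewrite mxE; apply/eqP/negPn/H.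
have [y hy] := psi_nontrivial.
pose t0 : 'rV[F]_k := (y / c i 0) *: delta_mx 0 i.
have ht0 : (t0 *m c) 0 0 = y by rewrite -scalemxAl -rowE !mxE mulfVK.
set S := LHS.
have : S = psi y * S.
  rewrite {1}/S (reindex_inj (addrI t0)) /S mulr_sumr.
  by apply: eq_bigr => t _; rewrite mulmxDl mxE psiD ht0.
move/eqP; rewrite -subr_eq0 -{1}[S]mul1r -mulrBl mulf_eq0 subr_eq0 eq_sym.
by rewrite (negPf hy) => /eqP.
Qed.

(** The row space is parametrized by coordinates in a row basis, which turns the
    sum into the one over a full space of row vectors. *)
Lemma sum_char_rowspace m n (A : 'M[F]_(m, n)) (c : 'cV[F]_n) :
  \sum_(v : 'rV_n | (v <= A)%MS) psi ((v *m c) 0 0)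
    = if A *m c == 0 then q ^+ \rank A else 0.
Proof.
rewrite (reindex_onto (fun t : 'rV_(\rank A) => t *m row_base A)
                      (fun v => v *m pinvmx (row_base A))); last first.
  by move=> v vA; rewrite mulmxKpV // eq_row_base.
rewrite (eq_bigl xpredT) => [|t]; last first.
  rewrite -(eq_row_base A) submxMl /=; apply/eqP.
  apply: (row_free_inj (row_base_free A)); rewrite mulmxKpV //.
  by rewrite submxMl.
under eq_bigr => t _ do rewrite -mulmxA.
rewrite sum_char_linear; congr (if _ then _ else _).
apply/eqP/eqP => h.
  have /submxP[D ->] : (A <= row_base A)%MS by rewrite eq_row_base.
  by rewrite -mulmxA h mulmx0.
have /submxP[D ->] : (row_base A <= A)%MS by rewrite eq_row_base.
by rewrite -mulmxA h mulmx0.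
Qed.

Lemma sum_char_scalar (b : F) :
  \sum_(a : F) psi (a * b) = if b == 0 then q else 0.
Proof.
have := sum_char_linear (b%:M : 'cV_1).
rewrite expr1 (_ : (b%:M == 0 :> 'cV[F]_1) = (b == 0)); last first.
  by apply/eqP/eqP => [/matrixP/(_ 0 0)|->]; rewrite ?mxE // raddf0.
move=> <-; rewrite (reindex (fun t : 'rV[F]_1 => t 0 0)) /=; last first.
  exists (fun a => a%:M) => [t _|a _]; last by rewrite mxE.
  by rewrite -mx11_scalar.
by apply: eq_bigr => t _; rewrite mxE big_ord1 mxE.
Qed.

End AdditiveCharacter.

(** * Rank of a bordered matrix *)

Section Bordering.
Variables (F : finFieldType) (eps : F).
Hypothesis eps2 : eps * eps = 1.

Definition selfadj n : pred 'M[F]_n := [pred A | A^T == eps *: A].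

(** For selfadjoint [A] and a corner [a] with [a = eps * a] this is again
    selfadjoint, and every selfadjoint matrix of size [1 + n] is of this form. *)
Definition border n (a : F) (v : 'rV[F]_n) (A : 'M[F]_n) : 'M_(1 + n) :=
  block_mx a%:M v (eps *: v^T) A.

Lemma eps_neq0 : eps != 0.
Proof.
by apply: contraTneq isT => e0; move/eqP: eps2; rewrite e0 mul0r eq_sym oner_eq0.
Qed.

Lemma selfadj_trK n (A : 'M[F]_n) : selfadj A -> eps *: A^T = A.
Proof. by move/eqP->; rewrite scalerA eps2 scale1r. Qed.

Lemma selfadj_border n a (v : 'rV[F]_n) A :
  selfadj (border a v A) = (a == eps * a) && selfadj A.
Proof.
rewrite /selfadj /= /border tr_block_mx scale_block_mx linearZ /= trmxK tr_scalar_mx.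
rewrite scale_scalar_mx scalerA eps2 scale1r.
apply/eqP/andP => [/eq_block_mx[/matrixP/(_ 0 0) ha _ _ ->]|[/eqP <- /eqP <-]] //.
by rewrite !mxE !mulr1n in ha; rewrite {1}ha !eqxx.
Qed.

Lemma border_submx n (A : 'M[F]_(1 + n)) : selfadj A ->
  border (ulsubmx A 0 0) (ursubmx A) (drsubmx A) = A.
Proof.
move=> sA; rewrite /border -mx11_scalar -[RHS]submxK; congr block_mx.
by rewrite -[in RHS](selfadj_trK sA); apply/matrixP => i j; rewrite !mxE.
Qed.

Lemma sum_border n (f : 'M[F]_(1 + n) -> algC) :
  \sum_(A | selfadj A) f A
    = \sum_(A | selfadj A) \sum_(v : 'rV_n) \sum_(a | a == eps * a) f (border a v A).
Proof.
rewrite (reindex_onto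
  (fun t : 'M_n * ('rV_n * F) => border t.2.2 t.2.1 t.1)
  (fun A => (drsubmx A, (ursubmx A, ulsubmx A 0 0)))) => [|A sA]; last first.
  exact: border_submx.
rewrite [LHS](eq_bigl (fun t => selfadj t.1 && (t.2.2 == eps * t.2.2))).
  under [RHS]eq_bigr => A _ do rewrite pair_big_dep.
  by rewrite pair_big_dep.
move=> [A [v a]] /=; rewrite selfadj_border /border block_mxKdr block_mxKur.
by rewrite block_mxKul mxE mulr1n eqxx andbT andbC.
Qed.

Lemma quad_selfadj n (w : 'rV[F]_n) A : selfadj A ->
  (w *m A *m w^T) 0 0 = eps * (w *m A *m w^T) 0 0.
Proof.
move=> sA; set x := w *m A *m w^T.
have : x^T = eps *: x.
  by rewrite /x !trmx_mul trmxK (eqP sA) -scalemxAl -scalemxAr mulmxA.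
by move/matrixP/(_ 0 0); rewrite !mxE.
Qed.

Lemma unitmx_utri n (w : 'rV[F]_n) :
  (block_mx 1%:M w 0 1%:M : 'M_(1 + n)) \in unitmx.
Proof. by rewrite unitmxE det_ublock !det1 mulr1 unitr1. Qed.

(** Subtracting [w] times the lower rows from the first one, and likewise for
    columns, leaves [a - w A w^T] in the corner and [A] below it. *)
Lemma rank_border_in n a (w : 'rV[F]_n) A : selfadj A ->
  \rank (border a (w *m A) A) = ((a != (w *m A *m w^T) 0 0)%R + \rank A)%N.
Proof.
move=> sA.
have hw : eps *: (w *m A)^T = A *m w^T.
  by rewrite trmx_mul (eqP sA) -scalemxAl scalerA eps2 scale1r.
rewrite /border hw; set P := block_mx 1%:M (- w) 0 1%:M : 'M[F]_(1 + n).
have uP : P \in unitmx by exact: unitmx_utri.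
have uPt : P^T \in unitmx by rewrite unitmx_tr.
rewrite -(mxrankMfree _ (_ : row_free P^T)) ?row_free_unit //.
rewrite -(eqmxMfull _ (_ : row_full P)) ?row_full_unit //.
have -> : P *m (block_mx a%:M (w *m A) (A *m w^T) A *m P^T)
         = block_mx (a%:M - w *m A *m w^T) 0 0 A.
  rewrite /P tr_block_mx !trmx1 !trmx0 linearN /= !mulmx_block.
  by rewrite !(mul1mx, mulmx1, mul0mx, mulmx0, add0r, addr0, mulNmx, mulmxN, mulmxA)
             !subrr mulmx0 subr0.
rewrite rank_diag_block_mx; congr addn.
rewrite rank_rV; congr nat_of_bool.
rewrite subr_eq0.
rewrite [w *m A *m w^T in LHS]mx11_scalar; congr negb.
by apply/eqP/eqP => [/matrixP/(_ 0 0)|->]; rewrite // !mxE.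
Qed.

Lemma rank_col_mx_notin m n (v : 'rV[F]_n) (A : 'M[F]_(m, n)) :
  ~~ (v <= A)%MS -> \rank (col_mx v A) = (\rank A).+1.
Proof.
move=> vA; rewrite -addsmxE.
have v_neq0 : v != 0 by apply: contraNneq vA => ->; rewrite sub0mx.
rewrite mxrank_disjoint_sum; first by rewrite rank_rV v_neq0.
apply/eqP; rewrite -mxrank_eq0; apply: contraNT vA; rewrite -lt0n => h.
apply: submx_trans (capmxSr v A).
rewrite -(geq_leqif (mxrank_leqif_sup (capmxSl v A))).
by rewrite rank_rV v_neq0.
Qed.

(** Both the first row and, by selfadjointness, the first column are independent
    of the others. *)
Lemma rank_border_notin n a (v : 'rV[F]_n) A : selfadj A ->
  ~~ (v <= A)%MS -> \rank (border a v A) = (\rank A).+2.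
Proof.
move=> sA vA.
have e_neq0 := eps_neq0.
rewrite /border /block_mx rank_col_mx_notin; last first.
  apply: contra vA => /submxP[D]; rewrite mul_mx_row => /eq_row_mx[_ ->].
  exact: submxMl.
congr S; rewrite -mxrank_tr tr_row_mx linearZ /= trmxK.
rewrite rank_col_mx_notin ?mxrank_tr // (eqP sA).
by rewrite (eqmx_scale _ e_neq0) (eqmx_scale _ e_neq0).
Qed.

End Bordering.

(** * The generating function of character sums by rank and its recursions *)

(** The coefficient of [z ^+ r] is the character sum over matrices of rank [r];
    products with the transpose keep the pairing uniform in [eps]. *)
Definition genfun (F : finFieldType) (eps : F) (psi : F -> algC) n (B : 'M[F]_n)
    (z : algC) : algC :=
  \sum_(A | selfadj eps A) psi (\tr (B *m A^T)) * z ^+ \rank A.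

Section GeneratingFunction.
Variables (F : finFieldType) (eps : F) (psi : F -> algC).
Let q : algC := #|F|%:R.
Hypothesis eps2 : eps * eps = 1.
Hypothesis two_neq0 : 2%:R != 0 :> F.
Hypothesis psiD : {morph psi : x y / x + y >-> x * y}.
Hypothesis psi0 : psi 0 = 1.
Hypothesis psi_nontrivial : exists y, psi y != 1.

Definition corner_card : algC := #|[pred a | a == eps * a]|%:R.
Let c := corner_card.

Lemma tr_border n (u v : 'rV[F]_n) b a B A :
  \tr (border eps b u B *m (border eps a v A)^T)
    = b * a + (v *m (u + u)^T) 0 0 + \tr (B *m A^T).
Proof.
rewrite /border tr_block_mx mulmx_block mxtrace_block tr_scalar_mx linearZ /= trmxK.
rewrite !mxtraceD -scalar_mxM mxtrace_scalar -scalemxAl -scalemxAr scalerA eps2.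
rewrite scale1r mulr1n (mxtrace_mulC u^T v) -[u *m v^T]trmxK trmx_mul trmxK.
rewrite mxtrace_tr.
rewrite [v *m u^T]mx11_scalar mxtrace_scalar linearD /= mulmxDr !mxE mulr1n.
by rewrite !addrA.
Qed.

(** In the row space of [A] exactly one corner value keeps the rank and all others
    raise it by 1; outside of it every corner value raises it by 2. *)
Lemma sum_border_corner n (v : 'rV[F]_n) A z : selfadj eps A ->
  \sum_(a | a == eps * a) z ^+ \rank (border eps a v A)
    = z ^+ \rank A * (if (v <= A)%MS then 1 + (c - 1) * z else c * z ^+ 2).
Proof.
move=> sA; case: ifPn => [/submxP[w ->]|vA]; last first.
  under eq_bigr => a _ do rewrite rank_border_notin //.
  rewrite sumr_const -mulr_natl -/corner_card -/c.
  by rewrite -(addn2 (\rank A)) exprD; ring.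
under eq_bigr => a _ do rewrite rank_border_in //.
rewrite (bigD1 ((w *m A *m w^T) 0 0)) /=; last by rewrite -quad_selfadj.
rewrite eqxx add0n.
under eq_bigr => a /andP[_ ->] do rewrite add1n exprSr.
rewrite sumr_const mulrDr mulr1 -mulr_natl; congr (_ + _).
have -> : c = 1 + #|[pred a | (a == eps * a) && (a != (w *m A *m w^T) 0 0)]|%:R.
  rewrite /c /corner_card (cardD1x (j := (w *m A *m w^T) 0 0)) ?natrD //.
  by rewrite /= -quad_selfadj.
rewrite [X in _ = _ * ((X - 1) * _)]addrC addrK mulrCA mulrC.
by rewrite -!mulrA [z * _]mulrC.
Qed.

(** For a zero corner in the fixed matrix, the character ignores the corner [a] of
    the summation variable, so the rows [v] contribute only character sums over
    the row space of [A] and over the whole space. *)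
Lemma genfun_border n (u : 'rV[F]_n) (B : 'M_n) z :
  genfun eps psi (border eps 0 u B) z =
    \sum_(A | selfadj eps A) psi (\tr (B *m A^T)) * z ^+ \rank A *
       ((if A *m u^T == 0 then q ^+ \rank A else 0) * (1 + (c - 1) * z - c * z ^+ 2)
        + (if u == 0 then q ^+ n else 0) * (c * z ^+ 2)).
Proof.
rewrite /genfun (sum_border eps2); apply: eq_bigr => A sA.
under eq_bigr => v _.
  under eq_bigr => a _ do rewrite tr_border mul0r add0r psiD -mulrA mulrCA.
  rewrite -mulr_sumr -mulr_sumr sum_border_corner //.
  over.
rewrite -mulr_sumr -mulrA; congr (_ * _).
have scale_eq0 m (D : 'M_(m, n)) : (D *m (u + u)^T == 0) = (D *m u^T == 0).
  rewrite -mulr2n -scaler_nat linearZ /= -scalemxAr scaler_eq0.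
  by rewrite (negPf two_neq0).
have all_v := sum_char_linear psiD psi0 psi_nontrivial (u + u)^T.
have uu_eq0 : ((u + u)^T == 0) = (u == 0).
  by rewrite -[_^T]mul1mx scale_eq0 mul1mx trmx_eq0.
rewrite uu_eq0 in all_v.
have row_v := sum_char_rowspace psiD psi0 psi_nontrivial A (u + u)^T.
rewrite scale_eq0 in row_v.
rewrite -row_v -all_v.
under eq_bigr => v _ do rewrite mulrCA.
rewrite -mulr_sumr; congr (_ * _).
rewrite [in RHS](bigID (fun v : 'rV_n => (v <= A)%MS) xpredT) /=.
rewrite [LHS](bigID (fun v : 'rV_n => (v <= A)%MS)) /=.
under eq_bigr => v vA do rewrite vA.
rewrite -mulr_suml.
under [X in _ + X = _]eq_bigr => v vA do rewrite (negPf vA).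
rewrite -mulr_suml.
by ring.
Qed.

Lemma genfun_zero n (B : 'M_n) z :
  genfun eps psi (block_mx 0 0 0 B : 'M_(1 + n)) z
   = (1 + (c - 1) * z - c * z ^+ 2) * genfun eps psi B (q * z)
     + q ^+ n * (c * z ^+ 2) * genfun eps psi B z.
Proof.
have -> : block_mx 0 0 0 B = border eps 0 0 B.
  by rewrite /border trmx0 scaler0 raddf0.
rewrite genfun_border /genfun !mulr_sumr -big_split /=.
apply: eq_bigr => A sA; rewrite trmx0 mulmx0 !eqxx exprMn; ring.
Qed.

(** The orthogonal sum of a hyperbolic plane, with Gram matrix [(0, 1; eps, 0)],
    and [B]; written as a double border so that the bordering recursion applies
    twice. *)
Definition hypblock n (B : 'M[F]_n) : 'M_(1 + (1 + n)) :=
  border eps 0 (row_mx 1%:M 0) (block_mx 0 0 0 B).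

(** Only the matrices [A] killed by the first basis vector survive in
    [genfun_border], and these are the ones supported on the last [n] rows. *)
Lemma genfun_hyp n (B : 'M_n) z :
  genfun eps psi (hypblock B) z
   = (1 + (c - 1) * z - c * z ^+ 2) * genfun eps psi B (q * z).
Proof.
rewrite genfun_border (sum_border eps2) /genfun mulr_sumr.
have -> : row_mx 1%:M 0 == 0 :> 'rV[F]_(1 + n) = false.
  rewrite -row_mx0; apply/eqP => /eq_row_mx[/matrixP/(_ 0 0)]; rewrite !mxE.
  by move/eqP; rewrite oner_eq0.
apply: eq_bigr => A sA.
have e_neq0 := eps_neq0 eps2.
have border_e0 v a :
    (border eps a v A *m (row_mx 1%:M 0)^T == 0) = (v == 0) && (a == 0).
  rewrite tr_row_mx trmx1 trmx0 /border mul_block_col !mulmx0 !mulmx1 !addr0.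
  have -> : col_mx a%:M (eps *: v^T) == 0 = (a%:M == 0 :> 'M_1) && (v == 0).
    by rewrite col_mx_eq0 scaler_eq0 (negPf e_neq0) trmx_eq0.
  rewrite andbC; congr andb.
  by apply/eqP/eqP => [/matrixP/(_ 0 0)|->]; rewrite ?mxE // raddf0.
rewrite (bigD1 0) //= (bigD1 0) ?mulr0 //=.
rewrite big1 ?addr0 => [|a /andP[_ a0]]; last first.
  by rewrite border_e0 eqxx (negPf a0) /= !mul0r addr0 mulr0.
rewrite big1 ?addr0 => [|v v0]; last first.
  by apply: big1 => a _; rewrite border_e0 (negPf v0) /= !mul0r addr0 mulr0.
rewrite border_e0 !eqxx /= mul0r addr0.
have -> : block_mx 0 0 0 B = border eps 0 0 B.
  by rewrite /border trmx0 scaler0 raddf0.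
rewrite tr_border mul0r mul0mx mxE !add0r.
have -> : \rank (border eps 0 0 A) = \rank A.
  by rewrite /border trmx0 scaler0 raddf0 rank_diag_block_mx mxrank0.
by rewrite exprMn; ring.
Qed.

Lemma genfun_congr n (P B : 'M[F]_n) z : P \in unitmx ->
  genfun eps psi (P *m B *m P^T) z = genfun eps psi B z.
Proof.
move=> uP; have uPt : P^T \in unitmx by rewrite unitmx_tr.
rewrite /genfun [RHS](reindex (fun A => P^T *m A *m P)) /=; last first.
  exists (fun A => invmx P^T *m A *m invmx P) => A _.
    by rewrite -!mulmxA mulmxV // mulmx1 mulKmx.
  by rewrite -!mulmxA mulVmx // mulmx1 mulKVmx.
apply: eq_big => [A|A _].
  rewrite /selfadj /= !trmx_mul trmxK mulmxA scalemxAl scalemxAr.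
  apply/eqP/eqP => [->//|/(congr1 (fun X => invmx P^T *m X *m invmx P))].
  by rewrite -!mulmxA mulmxV // !mulmx1 !mulKmx.
rewrite !trmx_mul trmxK; congr (psi _ * _ ^+ _).
  by rewrite -!mulmxA mxtrace_mulC -!mulmxA.
rewrite mxrankMfree ?row_free_unit //.
by rewrite eqmxMfull // row_full_unit.
Qed.

End GeneratingFunction.

(** * Splitting off radical lines and hyperbolic planes *)

Section Splitting.
Variables (F : finFieldType) (eps : F).
Hypothesis eps2 : eps * eps = 1.
Hypothesis two_neq0 : 2%:R != 0 :> F.

Lemma selfadj_congr k n (P : 'M[F]_(k, n)) B :
  selfadj eps B -> selfadj eps (P *m B *m P^T).
Proof.
move=> /eqP sB; apply/eqP.
by rewrite !trmx_mul trmxK sB -scalemxAl -scalemxAr mulmxA.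
Qed.

Lemma rank_congr n (P B : 'M[F]_n) :
  P \in unitmx -> \rank (P *m B *m P^T) = \rank B.
Proof.
move=> uP; rewrite mxrankMfree ?row_free_unit ?unitmx_tr //.
by rewrite eqmxMfull // row_full_unit.
Qed.

Lemma selfadj_flip k l n (x : 'M[F]_(k, n)) (y : 'M_(l, n)) B :
  selfadj eps B -> y *m B *m x^T = eps *: (x *m B *m y^T)^T.
Proof.
move=> sB; rewrite !trmx_mul trmxK -{1}(selfadj_trK eps2 sB).
by rewrite -scalemxAr -scalemxAl mulmxA.
Qed.

Lemma row_base_of_rank m n r (K : 'M[F]_(m, n)) :
  \rank K = r -> exists Z : 'M_(r, n), (Z :=: K)%MS.
Proof. by move=> <-; exists (row_base K); apply: eq_row_base. Qed.

(** A complement of the line spanned by [x] supplies the other rows of a basis. *)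
Lemma complete_row n (x : 'rV[F]_(1 + n)) :
  x != 0 -> exists Z : 'M_(n, 1 + n), col_mx x Z \in unitmx.
Proof.
move=> x_neq0.
have [|Z eqZ] := @row_base_of_rank _ _ n (x^C)%MS.
  by rewrite mxrank_compl rank_rV x_neq0 add1n subn1.
exists Z; rewrite -row_full_unit -sub1mx -addsmxE (adds_eqmx (eqmx_refl x) eqZ).
by rewrite sub1mx; apply: addsmx_compl_full.
Qed.

(** A kernel vector of [B] is completed to a basis. *)
Lemma split_zero n (B : 'M[F]_(1 + n)) : selfadj eps B -> (\rank B <= n)%N ->
  exists P B', P \in unitmx /\ P *m B *m P^T = block_mx 0 0 0 B'.
Proof.
move=> sB rB.
have [x /sub_kermxP xB x_neq0] : exists2 x, (x <= kermx B)%MS & x != 0 :> 'rV_(1 + n).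
  apply/rowV0Pn; rewrite -mxrank_eq0 mxrank_ker subn_eq0 -ltnNge.
  by rewrite -ltnS in rB.
have [Z uP] := complete_row x_neq0.
exists (col_mx x Z), (Z *m B *m Z^T); split=> //.
have Bx : B *m x^T = 0.
  by rewrite -(selfadj_trK eps2 sB) -scalemxAl -trmx_mul xB trmx0 scaler0.
rewrite mul_col_mx tr_col_mx mul_col_row xB !mul0mx.
by rewrite -mulmxA Bx mulmx0.
Qed.

(** The rows of [Z] are a basis of the orthogonal complement of the plane spanned
    by [x] and [y].  The last clause, which describes this complement, serves to
    place a frame of [B] inside it. *)
Lemma split_hyp n (B : 'M[F]_(1 + (1 + n))) (x y : 'rV_(1 + (1 + n))) :
  selfadj eps B -> x *m B *m x^T = 0 -> y *m B *m y^T = 0 -> x *m B *m y^T = 1%:M ->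
  exists Z : 'M_(n, 1 + (1 + n)),
    [/\ col_mx x (col_mx y Z) \in unitmx,
        col_mx x (col_mx y Z) *m B *m (col_mx x (col_mx y Z))^T
          = hypblock eps (Z *m B *m Z^T)
      & forall k (V : 'M_(k, _)),
          (V <= Z)%MS = (V *m B *m x^T == 0) && (V *m B *m y^T == 0)].
Proof.
move=> sB xx yy xy.
have yx : y *m B *m x^T = eps%:M.
  by rewrite (selfadj_flip _ _ sB) xy trmx1 scalemx1.
have e_neq0 := eps_neq0 eps2.
pose W := B *m (col_mx x y)^T.
have rW : \rank W = 2.
  apply/eqP; rewrite eqn_leq rank_leq_col /=.
  have <- : \rank (col_mx x y *m W) = 2.
    rewrite /W mulmxA mul_col_mx tr_col_mx mul_col_row xx xy yx yy.
    rewrite -[block_mx _ _ _ _]mul1mx.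
    apply: mxrank_unit; rewrite mul1mx.
    have -> : block_mx 0 1%:M eps%:M 0 = border eps 0 1%:M 0.
      by rewrite /border trmx1 scalemx1 raddf0.
    rewrite -row_free_unit /row_free rank_border_notin ?mxrank0 //.
      by rewrite /selfadj /= trmx0 scaler0.
    by rewrite submx0 -mxrank_eq0 mxrank1.
  exact: mxrankM_maxr.
have [|Z eqZ] := @row_base_of_rank _ _ n (kermx W).
  by rewrite mxrank_ker rW !add1n subn2.
have orthP k (V : 'M_(k, _)) :
    (V *m W == 0) = (V *m B *m x^T == 0) && (V *m B *m y^T == 0).
  by rewrite /W tr_col_mx mulmxA mul_mx_row row_mx_eq0.
have /eqP ZW : Z *m W == 0 by apply/eqP/sub_kermxP; rewrite eqZ.
have /andP[/eqP Zx /eqP Zy] : (Z *m B *m x^T == 0) && (Z *m B *m y^T == 0).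
  by rewrite -orthP ZW.
have xZ : x *m B *m Z^T = 0 by rewrite (selfadj_flip _ _ sB) Zx trmx0 scaler0.
have yZ : y *m B *m Z^T = 0 by rewrite (selfadj_flip _ _ sB) Zy trmx0 scaler0.
exists Z; split; last first.
- by move=> k V; rewrite eqZ -orthP; apply/sub_kermxP/eqP.
- rewrite !mul_col_mx !tr_col_mx !mul_mx_row xx xy xZ yx yy yZ Zx Zy.
  rewrite /hypblock /border tr_row_mx trmx1 trmx0 raddf0.
  rewrite scale_col_mx scaler0 scalemx1 [RHS]block_mxEv; congr col_mx.
  by rewrite [block_mx _ _ _ _]block_mxEv -block_mxEh -block_mxEv.
rewrite -row_free_unit -kermx_eq0; apply/rowV0P => v /sub_kermxP.
rewrite -[v]hsubmxK -[rsubmx v]hsubmxK !mul_row_col.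
set a := lsubmx v; set b := lsubmx _; set w := rsubmx (rsubmx v) => vP.
have b0 : b = 0.
  have := congr1 (fun X => X *m (B *m x^T)) vP.
  rewrite mul0mx !mulmxDl -!mulmxA 3!(mulmxA _ B) xx yx Zx !mulmx0 add0r addr0.
  by rewrite mul_mx_scalar => /eqP; rewrite scaler_eq0 (negPf e_neq0) => /eqP.
have a0 : a = 0.
  have := congr1 (fun X => X *m (B *m y^T)) vP.
  by rewrite mul0mx !mulmxDl -!mulmxA 3!(mulmxA _ B) xy yy Zy !mulmx0 !addr0 mulmx1.
move: vP; rewrite a0 b0 !mul0mx !add0r => wZ.
have fZ : row_free Z by rewrite /row_free eqZ mxrank_ker rW !add1n subn2.
have -> : w = 0 by apply: (row_free_inj fZ); rewrite wZ mul0mx.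
by rewrite !row_mx0.
Qed.

(** Any [y0] with [x B y0^T = 1] can be moved along [x] to become isotropic; this
    needs 2 to be invertible when [eps = 1]. *)
Lemma hyp_partner n (B : 'M[F]_n) (x : 'rV_n) :
  selfadj eps B -> x *m B *m x^T = 0 -> x *m B != 0 ->
  exists y : 'rV_n, y *m B *m y^T = 0 /\ x *m B *m y^T = 1%:M.
Proof.
move=> sB xx /rV0Pn[i xBi].
pose y0 : 'rV[F]_n := ((x *m B) 0 i)^-1 *: delta_mx 0 i.
have xy0 : x *m B *m y0^T = 1%:M.
  apply/matrixP => j k; rewrite !ord1 linearZ /= -scalemxAr trmx_delta -colE.
  by rewrite mxE [col _ _ _ _]mxE mulVf // mxE.
clearbody y0; pose t := (y0 *m B *m y0^T) 0 0.
have y0y0 : y0 *m B *m y0^T = t%:M by rewrite -mx11_scalar.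
have et : t = eps * t by apply: quad_selfadj.
have y0x : y0 *m B *m x^T = eps%:M by rewrite (selfadj_flip _ _ sB) xy0 trmx1 scalemx1.
exists (y0 - (t / 2%:R) *: x).
have -> : (y0 - (t / 2%:R) *: x)^T = y0^T - (t / 2%:R) *: x^T.
  by apply/matrixP => i1 j1; rewrite !mxE.
rewrite mulmxBl !mulmxBr !mulmxBl -!scalemxAr -!scalemxAl.
rewrite xx xy0 y0x y0y0 !scaler0 !subr0; split=> //.
rewrite !scale_scalar_mx mulr1 -!raddfB /= (_ : _ - _ = 0) ?raddf0 //.
have -> : t / 2%:R * eps = t / 2%:R by rewrite mulrAC [t * eps]mulrC -et.
by field.
Qed.

End Splitting.

(** * Isotropic vectors of symmetric forms *)

Section Isotropy.
Variables (F : finFieldType).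

Lemma selfadj1P n (B : 'M[F]_n) : selfadj 1 B = (B^T == B).
Proof. by rewrite /selfadj /= scale1r. Qed.

(** The sets of values of [a s^2] and of [c - b t^2] have more than half as many
    elements as the field, whose order is odd, hence they meet. *)
Lemma binary_form_onto (a b c : F) : odd #|F| -> a != 0 -> b != 0 ->
  exists s t, a * s ^+ 2 + b * t ^+ 2 = c.
Proof.
move=> oddF a0 b0.
(* The fibres of such an [f] have at most 2 elements. *)
have half (f : F -> F) : (forall x y, f x = f y -> (y == x) || (y == - x)) ->
    (#|F| < #|[set f x | x in F]|.*2)%N.
  move=> fP.
  suff : (#|F| <= #|[set f x | x in F]|.*2)%N.
    rewrite leq_eqVlt => /orP[/eqP e|//].
    by move: oddF; rewrite e odd_double.
  have -> : #|[set f x | x in F]|.*2 = (\sum_(y in [set f x | x in F]) 2)%N.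
    by rewrite sum_nat_const muln2.
  rewrite -sum1_card (partition_big_imset f) /=.
  apply: leq_sum => y /imsetP[x _ ->]; rewrite sum1dep_card.
  apply: leq_trans (_ : #|[set x; - x]| <= 2)%N; last first.
    by rewrite cards2; case: (_ != _).
  apply: subset_leq_card; apply/subsetP => u; rewrite !inE => /eqP e.
  by rewrite fP // e.
have sq x y : x ^+ 2 = y ^+ 2 -> (y == x :> F) || (y == - x).
  by move=> e; rewrite -eqf_sqr e.
have hA := half (fun x => a * x ^+ 2) (fun x y e => sq x y (mulfI a0 e)).
have hB := half (fun x => c - b * x ^+ 2)
  (fun x y e => sq x y (mulfI b0 (oppr_inj (addrI c e)))).
set A := [set _ | x in F] in hA; set B := [set _ | x in F] in hB.
have [y] : exists y, y \in A :&: B.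
  apply/set0Pn; rewrite -card_gt0.
  have := subset_leq_card (subsetT (A :|: B)); rewrite cardsT.
  move=> AB; rewrite -(ltn_add2l #|A :|: B|) addn0 cardsUI.
  apply: leq_ltn_trans AB _.
  by rewrite -ltn_double doubleD -addnn -addSn leq_add // ltnW.
rewrite inE => /andP[/imsetP[s _ ->] /imsetP[t _ e]].
by exists s, t; rewrite e subrK.
Qed.

(** Of three pairwise orthogonal vectors, either one is isotropic, or the plane
    spanned by the first two takes the opposite of the value at the third. *)
Lemma isotropic_vector n (B : 'M[F]_n) : odd #|F| -> B^T = B -> (2 < n)%N ->
  exists2 x : 'rV_n, x != 0 & x *m B *m x^T = 0.
Proof.
move=> oddF sB n_gt2.
have orth k (C : 'M[F]_(n, k)) : (k < n)%N -> exists2 x : 'rV_n, x != 0 & x *m C = 0.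
  move=> kn; have : kermx C != 0.
    rewrite -mxrank_eq0 mxrank_ker subn_eq0 -ltnNge.
    exact: leq_ltn_trans (rank_leq_col C) kn.
  by case/rowV0Pn => x /sub_kermxP xC x0; exists x.
have [x1 x10 _] := orth 0 0 (ltnW (ltnW n_gt2)).
have [x2 x20 x21] := orth 1 (B *m x1^T) (ltnW n_gt2).
have [x3 x30] := orth 2 (B *m (col_mx x1 x2)^T) n_gt2.
rewrite tr_col_mx !mulmxA mul_mx_row -row_mx0 => /eq_row_mx[x31 x32].
rewrite mulmxA in x21.
have flip (x y : 'rV[F]_n) : x *m B *m y^T = 0 -> y *m B *m x^T = 0.
  by move=> xy; rewrite -[B]sB -mulmxA -trmx_mul -[y]trmxK -trmx_mul xy trmx0.
have [x1x1|a0] := eqVneq (x1 *m B *m x1^T) 0; first by exists x1.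
have [x2x2|b0] := eqVneq (x2 *m B *m x2^T) 0; first by exists x2.
have sc (D : 'M[F]_1) : (D 0 0 == 0) = (D == 0).
  apply/eqP/eqP => [D0|->]; last by rewrite mxE.
  by apply/matrixP => i j; rewrite !ord1 D0 mxE.
rewrite -sc in a0; rewrite -sc in b0.
have [s [t st]] := binary_form_onto (- (x3 *m B *m x3^T) 0 0) oddF a0 b0.
pose x := s *: x1 + t *: x2 + x3.
have [x_0|x_n0] := eqVneq x 0.
  exists x3 => //.
  have : x *m B *m x3^T = 0 by rewrite x_0 !mul0mx.
  rewrite /x !mulmxDl -!scalemxAl (flip _ _ x31) (flip _ _ x32).
  by rewrite !scaler0 !add0r.
exists x => //.
apply/eqP; rewrite -sc.
have -> : x^T = s *: x1^T + t *: x2^T + x3^T by rewrite !linearD !linearZ.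
rewrite /x !(mulmxDl, mulmxDr) -!(scalemxAl, scalemxAr).
rewrite x21 x31 x32 (flip _ _ x21) (flip _ _ x31) (flip _ _ x32).
rewrite !scaler0 !addr0 !add0r.
have scE (u : F) (D : 'M[F]_1) : (u *: D) 0 0 = u * D 0 0 by rewrite mxE.
have addE (D E : 'M[F]_1) : (D + E) 0 0 = D 0 0 + E 0 0 by rewrite mxE.
rewrite !addE !scE; apply/eqP; rewrite -[RHS](addNr ((x3 *m B *m x3^T) 0 0)) -st.
ring.
Qed.

End Isotropy.

(** * Hyperbolic frames *)

Section HyperbolicFrames.
Variables (F : finFieldType).
Hypothesis two_neq0 : 2%:R != 0 :> F.

(** For [2s = \rank B] this is hyperbolicity, without the spanning condition,
    which follows from the rank (hyperbolicP).  The condition makes sense for any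
    [s], which allows induction on the number of planes. *)
Definition hypframe n (B : 'M[F]_n) s : Prop :=
  exists E G : 'M_(s, n),
    [/\ E *m B *m E^T = 0, G *m B *m G^T = 0 & E *m B *m G^T = 1%:M].

Lemma hypframe_congr k n (P : 'M[F]_(k, n)) B s :
  hypframe (P *m B *m P^T) s -> hypframe B s.
Proof.
case=> E [G [EE GG EG]]; exists (E *m P), (G *m P).
by split; rewrite trmx_mul; [rewrite -EE | rewrite -GG | rewrite -EG]; rewrite !mulmxA.
Qed.

Lemma hypframe_cons n k (B : 'M[F]_n) (Z : 'M_(k, n)) (x y : 'rV_n) s :
  B^T = B -> x *m B *m x^T = 0 -> y *m B *m y^T = 0 -> x *m B *m y^T = 1%:M ->
  Z *m B *m x^T = 0 -> Z *m B *m y^T = 0 ->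
  hypframe (Z *m B *m Z^T) s -> hypframe B s.+1.
Proof.
move=> sB xx yy xy Zx Zy [E [G [EE GG EG]]].
have flip u v (X : 'M[F]_(u, n)) (Y : 'M_(v, n)) : X *m B *m Y^T = (Y *m B *m X^T)^T.
  by rewrite !trmx_mul trmxK sB mulmxA.
exists (col_mx x (E *m Z)), (col_mx y (G *m Z)).
rewrite -[s.+1]/(1 + s)%N !tr_col_mx !mul_col_mx !mul_mx_row !trmx_mul.
have h u v (X : 'M[F]_(u, k)) (Y : 'M_(v, k)) :
  X *m Z *m B *m (Z^T *m Y^T) = X *m (Z *m B *m Z^T) *m Y^T by rewrite !mulmxA.
rewrite !h EE GG EG xx yy xy !mulmxA (flip _ _ x Z) (flip _ _ y Z) Zx Zy.
rewrite !trmx0 !mul0mx -!(mulmxA E) -!(mulmxA G) Zx Zy !mulmx0 !row_mx0 !col_mx0.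
by split=> //; rewrite -block_mxEv -scalar_mx_block.
Qed.

(** The first pair of a frame is split off; the others are orthogonal to it, hence
    lie in the complement spanned by [Z]. *)
Lemma hypframe_uncons n k (B : 'M[F]_n) s : B^T = B -> hypframe B s.+1 ->
  exists x y : 'rV_n,
    [/\ x *m B *m x^T = 0, y *m B *m y^T = 0, x *m B *m y^T = 1%:M
      & forall Z : 'M_(k, n),
          (forall l (V : 'M_(l, n)),
             (V <= Z)%MS = (V *m B *m x^T == 0) && (V *m B *m y^T == 0)) ->
          hypframe (Z *m B *m Z^T) s].
Proof.
move=> sB [E [G [EE GG EG]]].
have {E G EE GG EG} [x [E [y [G []]]]] :
    exists (x : 'rV_n) (E : 'M_(s, n)) (y : 'rV_n) (G : 'M_(s, n)),
    [/\ block_mx (x *m B *m x^T) (x *m B *m E^T) (E *m B *m x^T) (E *m B *m E^T) = 0,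
        block_mx (y *m B *m y^T) (y *m B *m G^T) (G *m B *m y^T) (G *m B *m G^T) = 0
      & block_mx (x *m B *m y^T) (x *m B *m G^T) (E *m B *m y^T) (E *m B *m G^T)
        = 1%:M].
  exists (usubmx (E : 'M_(1 + s, n))), (dsubmx (E : 'M_(1 + s, n))).
  exists (usubmx (G : 'M_(1 + s, n))), (dsubmx (G : 'M_(1 + s, n))).
  rewrite -!mul_col_row -!mul_col_mx -!tr_col_mx !vsubmxK.
  by split.
move/eqP; rewrite block_mx_eq0 => /and4P[/eqP xx /eqP xE /eqP Ex /eqP EE].
move/eqP; rewrite block_mx_eq0 => /and4P[/eqP yy /eqP yG /eqP Gy /eqP GG].
rewrite scalar_mx_block => /eq_block_mx[xy xG Ey EG].
exists x, y; split=> // Z ZP.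
have Gx : G *m B *m x^T = 0.
  by apply: trmx_inj; rewrite !trmx_mul trmxK sB mulmxA xG trmx0.
have /submxP[E' defE] : (E <= Z)%MS by rewrite ZP Ex Ey !eqxx.
have /submxP[G' defG] : (G <= Z)%MS by rewrite ZP Gx Gy !eqxx.
exists E', G'; rewrite defE defG !trmx_mul in EE GG EG.
by split; [rewrite -EE | rewrite -GG | rewrite -EG]; rewrite !mulmxA.
Qed.

Lemma quad_polar n (M : 'M[F]_n) :
  M^T = M -> (forall u : 'rV_n, (u *m M *m u^T) 0 0 = 0) -> M = 0.
Proof.
move=> sM Q; apply/matrixP => i j; rewrite mxE.
have e (u v : 'I_n) : M u v = (delta_mx 0 u *m M *m (delta_mx 0 v)^T : 'M_1) 0 0.
  by rewrite -rowE trmx_delta -colE !mxE.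
have := Q (delta_mx 0 i + delta_mx 0 j).
have -> : (delta_mx 0 i + delta_mx 0 j)^T
    = (delta_mx 0 i)^T + (delta_mx 0 j)^T :> 'M[F]_(n, 1).
  by rewrite linearD.
rewrite !(mulmxDl, mulmxDr).
have addE (D E : 'M[F]_1) : (D + E) 0 0 = D 0 0 + E 0 0 by rewrite mxE.
have sij : M j i = M i j by rewrite -{1}sM mxE.
rewrite !addE !Q -!e add0r addr0 sij -mulr2n -mulr_natl.
by move/eqP; rewrite mulf_eq0 (negPf two_neq0) => /eqP.
Qed.

(** A quadratic identity in all vectors of coordinates is an identity of Gram
    matrices by polarization.  The factor 2 between [G] and the second half of the
    frame comes from [u E + v G] having the cross term twice. *)
Lemma hyperbolicP n (B : 'M[F]_n) : B^T = B -> ~~ odd (\rank B) ->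
  reflect (hypframe B (\rank B)./2) (hyperbolic B).
Proof.
move=> sB eB; set s := (_)./2.
have flip u v (X : 'M[F]_(u, n)) (Y : 'M_(v, n)) : (X *m B *m Y^T)^T = Y *m B *m X^T.
  by rewrite !trmx_mul trmxK sB mulmxA.
have qE (E G : 'M_(s, n)) (u v : 'rV_s) :
  qform B (u *m E + v *m G) = (u *m (E *m B *m E^T) *m u^T) 0 0
    + 2%:R * (u *m (E *m B *m G^T) *m v^T) 0 0 + (v *m (G *m B *m G^T) *m v^T) 0 0.
  rewrite /qform.
  have -> : (u *m E + v *m G)^T = E^T *m u^T + G^T *m v^T.
    by rewrite linearD /= !trmx_mul.
  have addE (D C : 'M[F]_1) : (D + C) 0 0 = D 0 0 + C 0 0 by rewrite mxE.
  rewrite !(mulmxDl, mulmxDr) !addE !mulmxA.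
  have -> : (v *m G *m B *m E^T *m u^T) 0 0 = (u *m E *m B *m G^T *m v^T) 0 0.
    have tr11 (D : 'M[F]_1) : D^T 0 0 = D 0 0 by rewrite mxE.
    by rewrite -[LHS]tr11 !trmx_mul !trmxK sB !mulmxA.
  ring.
have dotE (u v : 'rV[F]_s) : \sum_i u 0 i * v 0 i = (u *m 1%:M *m v^T) 0 0.
  by rewrite mulmx1 mxE; apply: eq_bigr => i _; rewrite mxE.
apply: (iffP existsP) => [[E /existsP[G /andP[_ /forallP Q]]]|[E [G [EE GG EG]]]].
  have {}Q u v : qform B (u *m E + v *m G) = (u *m 1%:M *m v^T) 0 0.
    by rewrite -dotE; have /forallP/(_ v)/eqP := Q u.
  have EE : E *m B *m E^T = 0.
    apply: quad_polar; first by rewrite flip.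
    move=> u; have := Q u 0; rewrite qE trmx0 ?(mul0mx, mulmx0) ![(0 : 'M_1) 0 0]mxE.
    by rewrite mulr0 !addr0.
  have GG : G *m B *m G^T = 0.
    apply: quad_polar; first by rewrite flip.
    move=> u; have := Q 0 u; rewrite qE trmx0 ?(mul0mx, mulmx0) ![(0 : 'M_1) 0 0]mxE.
    by rewrite mulr0 !add0r.
  exists E, (2%:R *: G).
  rewrite linearZ /= -!scalemxAr -!scalemxAl GG !scaler0; split=> //.
  apply/matrixP => i j.
  have := Q (delta_mx 0 i) (delta_mx 0 j).
  rewrite qE EE GG !mulmx0 !mul0mx ![(0 : 'M_1) 0 0]mxE add0r addr0.
  by rewrite -!rowE trmx_delta -!colE !mxE.
exists E; apply/existsP; exists (2%:R^-1 *: G).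
apply/andP; split; last first.
  apply/forallP => u; apply/forallP => v; rewrite dotE qE.
  rewrite linearZ /= -!scalemxAr -!scalemxAl EE GG EG.
  rewrite !(mulmx0, mul0mx, scaler0) ![(0 : 'M_1) 0 0]mxE add0r addr0.
  by rewrite [X in _ * X]mxE mulVKf.
(* The Gram matrix J of the frame is invertible, so the frame is free and
   meets the radical trivially; a dimension count then gives the span. *)
pose C := col_mx E G; pose J : 'M[F]_(s + s) := block_mx 0 1%:M 1%:M 0.
have GE : G *m B *m E^T = 1%:M by rewrite -flip EG trmx1.
have CJ : C *m B *m C^T = J.
  by rewrite mul_col_mx tr_col_mx mul_col_row EE EG GE GG.
have JJ : J *m J = 1%:M.
  by rewrite mulmx_block !mul1mx !mul0mx !addr0 !add0r -scalar_mx_block.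
have J_inj (w : 'rV_(s + s)) : w *m C *m B = 0 -> w = 0.
  by move=> w0; rewrite -[w]mulmx1 -JJ -CJ !mulmxA w0 !mul0mx.
have freeC : row_free C.
  rewrite -kermx_eq0; apply/rowV0P => w /sub_kermxP w0.
  by apply: J_inj; rewrite w0 mul0mx.
have capC : (C :&: kermx B)%MS = 0.
  apply/eqP/rowV0P => v; rewrite sub_capmx => /andP[/submxP[w ->] /sub_kermxP w0].
  by rewrite (J_inj w w0) mul0mx.
have eqC : (E + 2%:R^-1 *: G + kermx B :=: C + kermx B)%MS.
  apply: adds_eqmx => //; apply: eqmx_trans (addsmxE E G).
  by apply: adds_eqmx => //; apply: eqmx_scale; rewrite invr_eq0.
rewrite submx1 sub1mx /row_full eqC mxrank_disjoint_sum // (eqnP freeC) mxrank_ker.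
by rewrite /= addnn /s even_halfK // subnKC ?rank_leq_row.
Qed.

End HyperbolicFrames.

(** * Evaluation of the generating functions *)

Section Evaluation.
Variables (F : finFieldType) (psi : F -> algC).
Let q : algC := #|F|%:R.
Hypothesis oddF : odd #|F|.
Hypothesis two_neq0 : 2%:R != 0 :> F.
Hypothesis psiD : {morph psi : x y / x + y >-> x * y}.
Hypothesis psi0 : psi 0 = 1.
Hypothesis psi_nontrivial : exists y, psi y != 1.

Let one2 : 1 * 1 = 1 :> F. Proof. exact: mulr1. Qed.
Let mone2 : -1 * -1 = 1 :> F. Proof. by rewrite mulrNN mulr1. Qed.

Lemma corner_card1 : corner_card (1 : F) = q.
Proof.
by congr (_%:R); apply: eq_card => a; rewrite !inE mul1r eqxx.
Qed.

Lemma corner_cardN1 : corner_card (-1 : F) = 1.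
Proof.
rewrite /corner_card (eq_card (B := pred1 0)) ?card1 // => a.
rewrite !inE mulN1r -subr_eq0 opprK -mulr2n -mulr_natl mulf_eq0.
by rewrite (negPf two_neq0).
Qed.

Definition rankgf (eps : F) n (z : algC) : algC :=
  \sum_(A : 'M_n | selfadj eps A) z ^+ \rank A.

Lemma genfun0 eps n z : genfun eps psi (0 : 'M_n) z = rankgf eps n z.
Proof. by apply: eq_bigr => A _; rewrite mul0mx mxtrace0 psi0 mul1r. Qed.

Lemma rankgf_skewS n z :
  rankgf (-1) n.+1 z
    = (1 - z ^+ 2) * rankgf (-1) n (q * z) + q ^+ n * z ^+ 2 * rankgf (-1) n z.
Proof.
have := genfun_zero mone2 two_neq0 psiD psi0 psi_nontrivial (0 : 'M_n) z.
rewrite block_mx_const !genfun0 corner_cardN1 => ->.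
by rewrite -/q; ring.
Qed.

Lemma rankgf_symS n z :
  rankgf 1 n.+1 z
    = (1 - z) * (1 + q * z) * rankgf 1 n (q * z) + q ^+ n.+1 * z ^+ 2 * rankgf 1 n z.
Proof.
have := genfun_zero one2 two_neq0 psiD psi0 psi_nontrivial (0 : 'M_n) z.
rewrite block_mx_const !genfun0 corner_card1 => ->.
by rewrite -/q [q ^+ n.+1]exprS; ring.
Qed.

Lemma genfun_dim0 eps (B : 'M_0) z : genfun eps psi B z = 1.
Proof.
rewrite /genfun (bigD1 0) /=; last by rewrite /selfadj /= trmx0 scaler0.
rewrite big1 ?addr0 => [|A /andP[_]]; last by rewrite [A]flatmx0 eqxx.
by rewrite mxrank0 trmx0 mulmx0 mxtrace0 psi0 mulr1.
Qed.

Lemma rankgf_dim0 eps z : rankgf eps 0 z = 1.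
Proof. by rewrite -genfun0 genfun_dim0. Qed.

(** The common value of the generating functions of skew-symmetric matrices of
    rank [2s] and size [n], see [genfun_skew]. *)
Fixpoint skewgf s n (z : algC) : algC :=
  if s is s'.+1 then (1 - z ^+ 2) * skewgf s' (n - 2)%N (q * z) else rankgf (-1) n z.

(** The two recursions of the generating functions commute, so the recursion for a
    zero row propagates from the zero matrix (rankgf_skewS) to all ranks. *)
Lemma skewgf_zero s n z : (s.*2 <= n)%N ->
  skewgf s n.+1 z
    = (1 - z ^+ 2) * skewgf s n (q * z) + q ^+ n * z ^+ 2 * skewgf s n z.
Proof.
elim: s n z => [|s IHs] n z; first by rewrite /= rankgf_skewS.
case: n => [|[|n]] // le_sn.
rewrite /= !subSS !subn0 IHs // -[n.+2]addn2 exprD; ring.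
Qed.

Lemma skewgf_even s n z : skewgf s n (- z) = skewgf s n z.
Proof.
elim: s n z => [|s IHs] n z /=; last by rewrite sqrrN mulrN IHs.
by elim: n z => [|n IHn] z; rewrite ?rankgf_dim0 // !rankgf_skewS sqrrN mulrN !IHn.
Qed.

Lemma rank_hypblock eps n (B : 'M[F]_n) : eps * eps = 1 -> selfadj eps B ->
  \rank (hypblock eps B) = (\rank B).+2.
Proof.
move=> eps2 sB; rewrite /hypblock rank_border_notin //.
- by rewrite rank_diag_block_mx mxrank0.
- have -> : block_mx 0 0 0 B = border eps 0 0 B.
    by rewrite /border trmx0 scaler0 raddf0.
  by rewrite selfadj_border // mulr0 eqxx.
apply/negP => /submxP[D].
rewrite -[D]hsubmxK mul_row_block !mulmx0 !addr0.
by move/eq_row_mx=> [/matrixP/(_ 0 0)/eqP]; rewrite !mxE oner_eq0.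
Qed.

(** Every vector is isotropic for a skew-symmetric form, so a nonzero one always
    splits off a hyperbolic plane. *)
Lemma genfun_skew s n (J : 'M_n) z : selfadj (-1) J -> \rank J = s.*2 ->
  genfun (-1) psi J z = skewgf s n z.
Proof.
elim: s n J z => [|s IHs] n J z sJ rJ.
  by move/eqP: rJ; rewrite mxrank_eq0 => /eqP->; rewrite genfun0.
have : (s.+1.*2 <= n)%N by rewrite -rJ rank_leq_row.
case: n J sJ rJ => [|[|n]] J sJ rJ // _.
have [x xJ] : exists x : 'rV_(n.+2), x *m J != 0.
  have /rowV0Pn[v /submxP[x ->] xJ] : J != 0 by rewrite -mxrank_eq0 rJ.
  by exists x.
have xx : x *m J *m x^T = 0.
  have := quad_selfadj x sJ; rewrite mulN1r => /eqP.
  rewrite -subr_eq0 opprK -mulr2n -mulr_natl mulf_eq0 (negPf two_neq0) /= => /eqP e.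
  by apply/matrixP => i j; rewrite !ord1 e mxE.
have [y [yy xy]] := hyp_partner mone2 two_neq0 sJ xx xJ.
have [Z [uP eP _]] := split_hyp mone2 (n := n) sJ xx yy xy.
have sZ := selfadj_congr Z sJ.
rewrite -(genfun_congr (-1) psi J z uP) eP.
rewrite (genfun_hyp mone2 two_neq0 psiD psi0 psi_nontrivial).
rewrite (IHs _ _ _ sZ) ?corner_cardN1 /= ?subSS ?subn0.
  by rewrite -/q; ring.
have := rank_congr J uP; rewrite eP (rank_hypblock mone2 sZ) rJ.
by case.
Qed.

(** The fibres of [w |-> w A] over the row space are translates of its kernel. *)
Lemma sum_rV_fibre n (A : 'M[F]_n) (f : 'rV[F]_n -> algC) g :
  (forall w, f w = g (w *m A)) ->
  q ^+ \rank A * \sum_w f w = q ^+ n * \sum_(v | (v <= A)%MS) g v.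
Proof.
move=> fg.
have kerA : \sum_(w : 'rV_n | (w <= kermx A)%MS) 1 = q ^+ (n - \rank A).
  have := sum_char_rowspace psiD psi0 psi_nontrivial (kermx A) 0.
  rewrite mulmx0 eqxx mxrank_ker => <-.
  by apply: eq_bigr => w _; rewrite mulmx0 mxE psi0.
rewrite (partition_big (fun w => w *m A) (fun v : 'rV_n => (v <= A)%MS)) /=; last first.
  by move=> w _; apply: submxMl.
have -> : q ^+ n = q ^+ \rank A * q ^+ (n - \rank A).
  by rewrite -exprD subnKC // rank_leq_row.
rewrite -mulrA; congr (_ * _).
rewrite mulr_sumr; apply: eq_bigr => v /submxP[w0 ->].
rewrite -kerA mulr_suml (reindex_inj (addIr w0)) /=.
apply: eq_big => [w|w /eqP e]; last by rewrite fg e mul1r.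
rewrite mulmxDl -subr_eq0 addrK; by apply/eqP/sub_kermxP.
Qed.

Lemma quad_well_defined n (A : 'M[F]_n) (w w' : 'rV[F]_n) : selfadj 1 A ->
  w *m A = w' *m A -> w *m A *m w^T = w' *m A *m w'^T.
Proof.
rewrite selfadj1P => /eqP sA e.
have e' : A *m w^T = A *m w'^T by rewrite -{1 2}sA -!trmx_mul e.
by rewrite e -!mulmxA e'.
Qed.

(** For a nonzero corner [b], the sum over the corner of [A] leaves only the rows
    [v = w A] and turns [b w A w^T] into a perturbation of [B] by [b w^T w].  This
    serves for the anisotropic forms, which have no isotropic vector to split
    along. *)
Lemma genfun_diag n b (u : 'rV[F]_n) B z : b != 0 ->
  q ^+ n * genfun 1 psi (border 1 b u B) z
    = (1 - z) * \sum_w genfun 1 psi (B + u^T *m w + w^T *m u + b *: (w^T *m w)) (q * z).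
Proof.
move=> b0; rewrite /genfun exchange_big (sum_border one2) !mulr_sumr /=.
apply: eq_bigr => A sA.
have /eqP tA : A^T == A by rewrite -selfadj1P.
(* The summand at [w] only depends on [v = w A], since [w A w^T] is the same for
   all [w] with a given image; [pinvmx] selects one of them. *)
pose g (v : 'rV[F]_n) :=
  psi ((v *m (u + u)^T) 0 0) * psi (b * (v *m (v *m pinvmx A)^T) 0 0).
pose f (w : 'rV[F]_n) := psi ((w *m A *m (u + u)^T) 0 0) * psi (b * (w *m A *m w^T) 0 0).
have fg w : f w = g (w *m A).
  congr (_ * psi (b * _)); rewrite -{2}(mulmxKpV (submxMl w A)).
  by rewrite (quad_well_defined sA (esym (mulmxKpV (submxMl w A)))).
have inner v : \sum_(a | a == 1 * a)
    psi (\tr (border 1 b u B *m (border 1 a v A)^T)) * z ^+ \rank (border 1 a v A)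
    = psi (\tr (B *m A^T)) * (z ^+ \rank A * (1 - z) * (if (v <= A)%MS then g v else 0)).
  have sum_b : \sum_a psi (b * a) = 0.
    under eq_bigr do rewrite mulrC.
    by rewrite (sum_char_scalar psiD psi0 psi_nontrivial) (negPf b0).
  rewrite (eq_bigl xpredT) => [|a]; last by rewrite mul1r eqxx.
  under eq_bigr do rewrite (tr_border one2) addrAC [_ + \tr _]addrC !psiD -!mulrA.
  rewrite -mulr_sumr; congr (_ * _).
  case: ifPn => [/submxP[w ->]|vA]; last first.
    under eq_bigr do rewrite rank_border_notin //.
    by rewrite -mulr_suml sum_b mul0r mulr0.
  under eq_bigr do rewrite rank_border_in // exprD.
  rewrite -fg /f (bigD1 ((w *m A *m w^T) 0 0)) //= eqxx expr0 mul1r.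
  move: sum_b; rewrite (bigD1 ((w *m A *m w^T) 0 0)) //= => /eqP.
  rewrite addrC addr_eq0 => /eqP sum_b.
  under eq_bigr => a a_neq do rewrite a_neq expr1.
  rewrite -mulr_suml sum_b; ring.
under eq_bigr do rewrite inner.
rewrite -mulr_sumr -mulr_sumr -big_mkcond /=.
have trE w : psi (\tr ((B + u^T *m w + w^T *m u + b *: (w^T *m w)) *m A^T))
    = psi (\tr (B *m A^T)) * f w.
  rewrite /f -psiD -psiD; congr psi.
  rewrite tA !mulmxDl !mxtraceD -!addrA; congr (_ + _).
  rewrite -scalemxAl mxtraceZ linearD /= mulmxDr.
  have tr11 (D : 'M[F]_1) : D 0 0 = \tr D by rewrite [in RHS](mx11_scalar D) mxtrace_scalar.
  rewrite !tr11 mxtraceD -!addrA; congr (_ + (_ + _ * _)).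
  - by rewrite -mulmxA mxtrace_mulC.
  - by rewrite -mulmxA mxtrace_mulC -mxtrace_tr !trmx_mul !trmxK tA mulmxA.
  by rewrite -mulmxA mxtrace_mulC.
under [in RHS]eq_bigr do rewrite trE exprMn.
rewrite -mulr_suml -mulr_sumr.
have := sum_rV_fibre fg.
move: (\sum_w f w) (\sum_(v | (v <= A)%MS) g v) => S1 S2 e.
transitivity (psi (\tr (B *m A^T)) * z ^+ \rank A * (1 - z) * (q ^+ n * S2)); first ring.
rewrite -e; ring.
Qed.

(** The generating function of a symmetric matrix of size [n] and rank [2l + 1]
    (with [tau = 0]) or [2l + 2] (with [tau] its type). *)
Definition symgf (tau : algC) l n (z : algC) : algC :=
  (1 - z) * (skewgf l (n - 1) (q * z)
             + tau * q ^+ (n - l - 1) * z * skewgf l (n - 2) (q * z)).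

(** The bounds say that a matrix of size [n] can have the rank in question, which
    is [2l + 1] if [tau = 0] and [2l + 2] otherwise. *)
Lemma symgf_zero tau l n z : (l.*2 < n)%N -> (tau = 0 \/ (l.*2.+1 < n)%N) ->
  symgf tau l n.+1 z
    = (1 - z) * (1 + q * z) * symgf tau l n (q * z)
      + q ^+ n.+1 * z ^+ 2 * symgf tau l n z.
Proof.
case: n => // n l_n tau_n.
rewrite /symgf !subSS !subn0 skewgf_zero // -/q.
case: tau_n => [-> | l_n2].
  by rewrite !mul0r !addr0 -[n.+2]addn2 exprD; ring.
case: n l_n l_n2 => // n l_n l_n2.
rewrite !subSS !subn0 (@skewgf_zero l n (q * z)) -/q; last by move: l_n2; clear; lia.
have -> : (n.+2 - l - 1 = (n - l).+1)%N by move: l_n2; clear; lia.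
have -> : (n.+3 - l - 1 = (n - l).+2)%N by move: l_n2; clear; lia.
rewrite -[n.+3]addn3 -[(n - l).+2]addn2 -[(n - l).+1]addn1 -[n.+1]addn1 !exprD; ring.
Qed.

Lemma symgf_hyp tau l n z : (l < n)%N ->
  symgf tau l.+1 n.+2 z = (1 - z) * (1 + q * z) * symgf tau l n (q * z).
Proof.
move=> l_n; rewrite /symgf /= !subSS !subn0 -/q.
have -> : (n.+1 - l - 1 = (n - l - 1).+1)%N by move: l_n; clear; lia.
rewrite -[(n - l - 1).+1]addn1 exprD; ring.
Qed.

(** The initial value of the hyperbolic case: a hyperbolic plane plus a zero form
    has rank 2, so that the form left after splitting has rank 0, outside of the
    range of [symgf]. *)
Lemma rankgf_sym_skew n w :
  (1 + w) * rankgf (1 : F) n w = skewgf 0 n.+1 w + q ^+ n * w * skewgf 0 n w.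
Proof.
elim: n w => [|n IHn] w /=.
  by rewrite rankgf_skewS !rankgf_dim0; ring.
rewrite rankgf_symS mulrDr -[LHS]/(_ + _) (mulrCA (1 + w) (q ^+ n.+1 * w ^+ 2)) IHn.
have -> : (1 + w) * ((1 - w) * (1 + q * w) * rankgf 1 n (q * w))
  = (1 + w) * (1 - w) * ((1 + q * w) * rankgf 1 n (q * w)) by ring.
rewrite IHn /= (rankgf_skewS n.+1 w) (rankgf_skewS n w) -/q -[n.+1]addn1 exprD; ring.
Qed.

Lemma hyp_step n (B : 'M[F]_(n.+2)) (x y : 'rV_(n.+2)) z :
  B^T = B -> x *m B *m x^T = 0 -> y *m B *m y^T = 0 -> x *m B *m y^T = 1%:M ->
  exists Z : 'M_(n, n.+2),
    [/\ Z *m B *m x^T = 0, Z *m B *m y^T = 0,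
        forall l (V : 'M_(l, n.+2)),
          (V <= Z)%MS = (V *m B *m x^T == 0) && (V *m B *m y^T == 0),
        \rank B = (\rank (Z *m B *m Z^T)).+2
      & genfun 1 psi B z
          = (1 - z) * (1 + q * z) * genfun 1 psi (Z *m B *m Z^T) (q * z)].
Proof.
move=> tB xx yy xy.
have sB : selfadj 1 B by rewrite selfadj1P tB.
have [Z [uP eP ZP]] := split_hyp one2 (n := n) sB xx yy xy.
have sZ := selfadj_congr Z sB.
have /andP[/eqP Zx /eqP Zy] : (Z *m B *m x^T == 0) && (Z *m B *m y^T == 0).
  by rewrite -ZP.
exists Z; split=> //.
  by have := rank_congr B uP; rewrite eP (rank_hypblock one2 sZ).
rewrite -(genfun_congr 1 psi B z uP) eP.
rewrite (genfun_hyp one2 two_neq0 psiD psi0 psi_nontrivial) corner_card1 -/q; ring.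
Qed.

(** Splitting along the frame leaves a hyperbolic form at each step, down to the
    zero form. *)
Lemma genfun_hyperbolic l n (B : 'M[F]_n) z :
  B^T = B -> \rank B = l.+1.*2 -> hypframe B l.+1 ->
  genfun 1 psi B z = symgf 1 l n z.
Proof.
elim: l n B z => [|l IHl] n B z tB rB hB.
all: have : (2 <= n)%N by rewrite (leq_trans _ (rank_leq_row B)) // rB.
all: case: n B tB rB hB => [|[|n]] // B tB rB hB _.
all: have [x [y [xx yy xy hZ]]] := hypframe_uncons n tB hB.
all: have [Z [_ _ ZP rZ ->]] := hyp_step z tB xx yy xy.
all: rewrite rB in rZ; case: rZ => rZ.
  move/esym/eqP: rZ; rewrite mxrank_eq0 => /eqP ->.
  rewrite genfun0 -mulrA rankgf_sym_skew /symgf !subSS !subn0 /= -/q.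
  by rewrite -[n.+1]addn1 exprD; ring.
rewrite (IHl _ _ _ _ (esym rZ) (hZ _ ZP)); last first.
  by rewrite !trmx_mul trmxK tB mulmxA.
rewrite symgf_hyp //.
by have := rank_leq_row (Z *m B *m Z^T); rewrite -rZ; clear; lia.
Qed.

Lemma genfun_scalar (C : 'M[F]_1) z : C 0 0 != 0 -> genfun 1 psi C z = 1 - z.
Proof.
move=> C0.
have -> : C = border 1 (C 0 0) (0 : 'rV_0) 0.
  have sC : selfadj 1 (C : 'M_(1 + 0)).
    by rewrite selfadj1P (mx11_scalar C) tr_scalar_mx.
  rewrite -{1}(border_submx one2 sC); congr border.
  - by rewrite !mxE; congr (C _ _); apply/val_inj.
  - by rewrite thinmx0.
  by rewrite flatmx0.
have := @genfun_diag 0 (C 0 0) 0 0 z C0; rewrite expr0 mul1r => ->.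
rewrite (eq_bigr (fun=> 1)) => [|w _]; last by rewrite genfun_dim0.
by rewrite sumr_const card_mx muln0 expn0 mulr1n mulr1.
Qed.

(** With [b] the corner of [B], the scalar appearing in [genfun_diag] for [w] is
    the value of the form at the vector [(w, 1)], hence nonzero. *)
Lemma genfun_anisotropic (B : 'M[F]_2) z :
  B^T = B -> (forall x : 'rV_2, x != 0 -> x *m B *m x^T != 0) ->
  genfun 1 psi B z = (1 - z) * (1 - q * z).
Proof.
move=> tB aB.
have sB : selfadj 1 (B : 'M_(1 + 1)) by rewrite selfadj1P tB.
have q_neq0 : q != 0 by rewrite Num.Theory.pnatr_eq0 -lt0n; apply/card_gt0P; exists 0.
have := border_submx one2 sB.
set b := ulsubmx _ 0 0; set u := ursubmx _; set B' := drsubmx _ => eB.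
have quad (a : F) (w : 'rV[F]_1) : (row_mx w a%:M) *m B *m (row_mx w a%:M)^T
    = a ^+ 2 *: B' + a *: (u^T *m w) + a *: (w^T *m u) + b *: (w^T *m w).
  have w1 : w^T = w by rewrite [w]mx11_scalar tr_scalar_mx.
  have u1 : u^T = u by rewrite [u]mx11_scalar tr_scalar_mx.
  transitivity (row_mx w a%:M *m border 1 b u B' *m (row_mx w a%:M)^T).
    by rewrite eB.
  rewrite /border tr_row_mx mul_row_block mul_row_col scale1r w1 u1 tr_scalar_mx.
  apply/matrixP => i j; rewrite !ord1 !(mxE, big_ord1) !eqxx !mulr1n; ring.
have sc (D : 'M[F]_1) : D != 0 -> D 0 0 != 0.
  by apply: contraNneq => D0; rewrite (mx11_scalar D) D0 raddf0.
have row_neq0 (a : F) (w : 'rV[F]_1) : row_mx w a%:M = 0 -> w = 0 /\ a = 0.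
  rewrite -row_mx0 => /eq_row_mx[-> /matrixP/(_ 0 0)].
  by rewrite !mxE eqxx mulr1n.
have b0 : b != 0.
  apply: (contra_neq _ (aB (row_mx 1%:M 0%:M) _)) => [b0|].
    by rewrite quad b0 trmx1 expr0n !scale0r !addr0.
  by apply/eqP => /row_neq0[/matrixP/(_ 0 0)/eqP]; rewrite !mxE oner_eq0.
have := @genfun_diag 1 b u B' z b0; rewrite eB.
rewrite (eq_bigr (fun=> 1 - q * z)) => [|w _]; last first.
  rewrite genfun_scalar //; apply: sc.
  have := aB (row_mx w 1%:M); rewrite quad expr1n !scale1r; apply.
  by apply/eqP => /row_neq0[_ /eqP]; rewrite oner_eq0.
rewrite sumr_const card_mx muln1 expn1 -mulr_natl -/q expr1 mulrCA.
exact: mulfI.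
Qed.

(** Degenerate forms lose a radical line; nondegenerate ones of dimension at least
    3 have an isotropic vector and lose a hyperbolic plane; those of dimension 2
    that are not hyperbolic are anisotropic. *)
Lemma genfun_nonhyperbolic n (B : 'M[F]_n) z :
  B^T = B -> (0 < \rank B)%N ->
  (~~ odd (\rank B) -> ~ hypframe B (\rank B)./2) ->
  genfun 1 psi B z
    = symgf (if odd (\rank B) then 0 else -1) (\rank B).-1./2 n z.
Proof.
have [k] := ubnP n; elim: k n B z => // k IHk n B z n_k tB rB nhB.
have sB : selfadj 1 B by rewrite selfadj1P tB.
have [rn|rn] := ltnP (\rank B) n.
  case: n B n_k tB rB nhB sB rn => // n B n_k tB rB nhB sB rn.
  have [P [B' [uP eP]]] := split_zero one2 (n := n) sB rn.
  have tB' : B'^T = B'.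
    have := selfadj_congr P sB; rewrite selfadj1P eP tr_block_mx.
    by move/eqP/eq_block_mx => [].
  have rB' : \rank B' = \rank B.
    have <- : \rank (block_mx 0 0 0 B' : 'M_(1 + n)) = \rank B.
      by rewrite -eP rank_congr.
    by rewrite rank_diag_block_mx mxrank0.
  rewrite -(genfun_congr 1 psi B z uP) eP.
  rewrite (genfun_zero one2 two_neq0 psiD psi0 psi_nontrivial) corner_card1 -/q.
  have nhB' : ~~ odd (\rank B') -> ~ hypframe B' (\rank B')./2.
    rewrite rB' => eB hB'; apply: (nhB eB).
    (* [B'] is the Gram matrix of the last [n] vectors of the basis [P]. *)
    apply: (hypframe_congr (P := row_mx 0 1%:M *m P)).
    rewrite trmx_mul !mulmxA -(mulmxA _ P) -(mulmxA _ (P *m B)) eP.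
    rewrite mul_row_block !mul0mx !mul1mx !add0r tr_row_mx mul_row_col.
    by rewrite trmx1 mulmx1 mul0mx add0r.
  rewrite !IHk ?rB' //; try by rewrite -rB'.
  rewrite symgf_zero; first by rewrite [q ^+ n.+1]exprS; ring.
  - by move: (\rank B) rB rn; clear; lia.
  case: ifP => oB; [by left | right].
  by move: (\rank B) rB rn oB; clear; lia.
have {}rn : \rank B = n by apply/eqP; rewrite eqn_leq rank_leq_row.
have uB : B \in unitmx by rewrite -row_free_unit /row_free rn.
have hyp_x (x : 'rV_n) : x != 0 -> x *m B *m x^T = 0 ->
    exists y : 'rV_n, y *m B *m y^T = 0 /\ x *m B *m y^T = 1%:M.
  move=> x0 xx; apply: (hyp_partner one2 two_neq0 sB xx).
  by apply: contraNneq x0 => xB; rewrite -[x](mulmxK uB) xB mul0mx.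
have [n_le2|n_gt2] := leqP n 2; last first.
  have [x x0 xx] := isotropic_vector oddF tB n_gt2.
  have [y [yy xy]] := hyp_x x x0 xx.
  case: n B n_k tB rB nhB sB rn uB hyp_x n_gt2 x y x0 xx yy xy => [|[|n]] //.
  move=> B n_k tB rB nhB sB rn uB _ n_gt2 x y x0 xx yy xy.
  have [Z [Zx Zy _ rZ ->]] := hyp_step z tB xx yy xy.
  have nhZ : ~~ odd (\rank (Z *m B *m Z^T)) ->
      ~ hypframe (Z *m B *m Z^T) (\rank (Z *m B *m Z^T))./2.
    move=> eZ /(hypframe_cons tB xx yy xy Zx Zy) hB; apply: nhB; rewrite rZ //=.
    by rewrite negbK.
  have {}rn : \rank (Z *m B *m Z^T) = n by move: rZ; rewrite rn => -[].
  have {}n_k : (n < k)%N by rewrite -ltnS ltnW.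
  have tZ : (Z *m B *m Z^T)^T = Z *m B *m Z^T by rewrite !trmx_mul trmxK tB mulmxA.
  have n_gt0 : (0 < n)%N by [].
  rewrite (IHk _ _ _ n_k tZ _ nhZ) rn // rZ rn /= negbK -symgf_hyp; last first.
    by move: n_gt0; clear; lia.
  by have -> : uphalf n = n.-1./2.+1 by case: (n) n_gt0.
case: n B n_k tB rB nhB sB rn uB hyp_x n_le2 => [|[|[|n]]] //.
- by move=> B _ _; rewrite (flatmx0 B) mxrank0.
- move=> B _ _ _ _ _ rn _ _ _.
  rewrite rn /= genfun_scalar; last first.
    apply: contra_eqN rn => /eqP B0; rewrite (mx11_scalar B) B0 raddf0 mxrank0.
    by [].
  by rewrite /symgf /= rankgf_dim0 !mul0r addr0 mulr1.
move=> B _ tB _ nhB _ rn _ hyp_x _.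
rewrite rn in nhB *; rewrite genfun_anisotropic //.
  by rewrite /symgf /= rankgf_skewS !rankgf_dim0 expr1 -/q; ring.
move=> x x0; apply/negP => /eqP xx; have [y [yy xy]] := hyp_x x x0 xx.
by apply: nhB => //; exists x, y.
Qed.

End Evaluation.

(** * Comparison of coefficients *)

Section Coefficients.
Variables (F : finFieldType) (psi : F -> algC).
Let q : algC := #|F|%:R.
Hypothesis two_neq0 : 2%:R != 0 :> F.
Hypothesis psiD : {morph psi : x y / x + y >-> x * y}.
Hypothesis psi0 : psi 0 = 1.
Hypothesis psi_nontrivial : exists y, psi y != 1.

Definition charsum (chi : F -> algC) (eps : F) n (B : 'M[F]_n) r : algC :=
  \sum_(A | selfadj eps A && (\rank A == r)) chi (\tr (B *m A^T)).

(** The powers of [c] rescale the variable (horner_rankpoly), so that [Phi(q z)]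
    is again of this form. *)
Definition rankpoly (chi : F -> algC) (c : algC) (eps : F) n (B : 'M[F]_n) :
    {poly algC} :=
  \sum_(A | selfadj eps A) (chi (\tr (B *m A^T)) * c ^+ \rank A) *: 'X^(\rank A).

Lemma horner_rankpoly chi c eps n (B : 'M_n) z :
  (rankpoly chi c eps B).[z] = genfun eps chi B (c * z).
Proof.
rewrite /rankpoly horner_sum; apply: eq_bigr => A _.
by rewrite hornerZ hornerXn exprMn mulrA.
Qed.

Lemma coef_rankpoly chi c eps n (B : 'M_n) r :
  (rankpoly chi c eps B)`_r = c ^+ r * charsum chi eps B r.
Proof.
rewrite coef_sum /charsum big_mkcondr mulr_sumr; apply: eq_bigr => A _ /=.
rewrite coefZ coefXn eq_sym; case: eqP => [->|_]; last by rewrite !mulr0.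
by rewrite mulr1 mulrC.
Qed.

Lemma poly_fun_inj (p1 p2 : {poly algC}) : (forall z, p1.[z] = p2.[z]) -> p1 = p2.
Proof.
move=> e; apply/eqP; rewrite -subr_eq0; apply/eqP.
apply: (@roots_geq_poly_eq0 _ _ [seq i%:R | i <- iota 0 (size (p1 - p2))]).
- by apply/allP => _ /mapP[i _ ->]; rewrite rootE hornerD hornerN e subrr.
- by rewrite map_inj_uniq ?iota_uniq // => i j /eqP; rewrite Num.Theory.eqr_nat => /eqP.
- by rewrite size_map size_iota.
Qed.

Lemma charsum_skew_eq n (J J' : 'M[F]_n) s r :
  selfadj (-1) J -> selfadj (-1) J' -> \rank J = s.*2 -> \rank J' = s.*2 ->
  charsum psi (-1) J r = charsum psi (-1) J' r.
Proof.
move=> sJ sJ' rJ rJ'.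
have e : rankpoly psi 1 (-1) J = rankpoly psi 1 (-1) J'.
  apply: poly_fun_inj => z; rewrite !horner_rankpoly.
  by rewrite !(genfun_skew two_neq0 psiD psi0 psi_nontrivial (s := s)).
have := congr1 (fun p : {poly algC} => p`_r) e.
by rewrite !coef_rankpoly expr1n !mul1r.
Qed.

(** The generating function is even in [z]. *)
Lemma charsum_skew_odd n (J : 'M[F]_n) s r :
  selfadj (-1) J -> \rank J = s.*2 -> odd r -> charsum psi (-1) J r = 0.
Proof.
move=> sJ rJ oddr.
have e : rankpoly psi 1 (-1) J = rankpoly psi (-1) (-1) J.
  apply: poly_fun_inj => z.
  rewrite !horner_rankpoly !(genfun_skew two_neq0 psiD psi0 psi_nontrivial (s := s)) //.
  by rewrite mul1r mulN1r (skewgf_even two_neq0 psiD psi0 psi_nontrivial).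
have := congr1 (fun p : {poly algC} => p`_r) e.
rewrite !coef_rankpoly expr1n mul1r -signr_odd oddr expr1 mulN1r => /eqP.
by rewrite -subr_eq0 opprK -mulr2n Num.Theory.mulrn_eq0 /= => /eqP.
Qed.

(** Coefficients of [z ^ (2r+1)], [1] and [z ^ (2r+2)]: the odd coefficients of the
    skew functions vanish, so only one term of each survives the multiplication by
    [1 - z]. *)
Lemma charsum_sym chi t k n k' (B : 'M[F]_k) (J : 'M[F]_n) (J' : 'M_k') s s' :
  selfadj (-1) J -> selfadj (-1) J' -> \rank J = s.*2 -> \rank J' = s'.*2 ->
  (forall z, genfun 1 chi B z =
     (1 - z) * (genfun (-1) psi J (q * z) + t * z * genfun (-1) psi J' (q * z))) ->
  forall r,
  [/\ charsum chi 1 B r.*2.+1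
        = - q ^+ r.*2 * charsum psi (-1) J r.*2 + t * q ^+ r.*2 * charsum psi (-1) J' r.*2,
      charsum chi 1 B 0 = charsum psi (-1) J 0
    & charsum chi 1 B r.+1.*2
        = q ^+ r.+1.*2 * charsum psi (-1) J r.+1.*2
          - t * q ^+ r.*2 * charsum psi (-1) J' r.*2].
Proof.
move=> sJ sJ' rJ rJ' e r.
pose C := rankpoly psi q (-1) J; pose D := rankpoly psi q (-1) J'.
have eP : rankpoly chi 1 1 B = C - 'X * C + t *: ('X * D) - t *: ('X * ('X * D)).
  apply: poly_fun_inj => z; rewrite horner_rankpoly mul1r e.
  by rewrite !(hornerD, hornerN, hornerZ, hornerM, hornerX) !horner_rankpoly; ring.
have cB i : charsum chi 1 B i = (rankpoly chi 1 1 B)`_i.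
  by rewrite coef_rankpoly expr1n mul1r.
have Codd i : odd i -> charsum psi (-1) J i = 0 by apply: charsum_skew_odd rJ.
have Dodd i : odd i -> charsum psi (-1) J' i = 0 by apply: charsum_skew_odd rJ'.
have odd_S i : odd i.*2.+1 by rewrite /= odd_double.
rewrite !cB eP !(coefD, coefN, coefZ, coefXM) /= !coef_rankpoly.
rewrite (Codd _ (odd_S r)) (Dodd _ (odd_S r)); split; last 2 first.
- by rewrite expr0 !mulr0 oppr0 !addr0 mul1r.
- by ring.
case: r => [|r] /=; first by rewrite !expr0; ring.
by rewrite (Dodd _ (odd_S r)); ring.
Qed.

End Coefficients.

(** * Weights and Krawtchouk polynomials *)

Lemma skew_exists (F : finFieldType) s n : (s.*2 <= n)%N ->
  exists2 J : 'M[F]_n, selfadj (-1) J & \rank J = s.*2.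
Proof.
have mone2 : -1 * -1 = 1 :> F by rewrite mulrNN mulr1.
elim: s n => [|s IHs] n s_n.
  by exists 0; rewrite ?mxrank0 // /selfadj /= trmx0 scaler0.
case: n s_n => [|[|n]] // s_n.
have [J sJ rJ] := IHs n s_n.
exists (hypblock (-1) J); last by rewrite rank_hypblock // rJ.
have border0 : block_mx 0 0 0 J = border (-1) 0 0 J.
  by rewrite /border trmx0 scaler0 raddf0.
rewrite /hypblock (selfadj_border mone2) border0 (selfadj_border mone2) sJ.
by rewrite mulr0 eqxx.
Qed.

Lemma tr_skew (F : finFieldType) n (A B : 'M[F]_n) : 2%:R != 0 :> F ->
  selfadj (-1) A -> selfadj (-1) B ->
  \tr (A *m B^T) = 2%:R * \sum_(i < n) \sum_(j < n | (i < j)%N) A i j * B i j.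
Proof.
move=> two_neq0.
have skewE (D : 'M[F]_n) : selfadj (-1) D -> forall i j, D j i = - D i j.
  by move=> /eqP/matrixP h i j; have := h i j; rewrite !mxE mulN1r.
move=> /skewE sA /skewE sB.
have -> : \tr (A *m B^T) = \sum_i \sum_j A i j * B i j.
  by apply: eq_bigr => i _; rewrite mxE; apply: eq_bigr => j _; rewrite mxE.
have split3 i : \sum_j A i j * B i j =
    \sum_(j < n | (i < j)%N) A i j * B i j + \sum_(j < n | (j < i)%N) A i j * B i j.
  rewrite (bigID (fun j : 'I_n => (i < j)%N)) /=; congr (_ + _).
  rewrite (bigD1 i) /= ?ltnn //.
  have /eqP : A i i = - A i i := sA i i.
  rewrite -subr_eq0 opprK -mulr2n -mulr_natl mulf_eq0 (negPf two_neq0) /= => /eqP->.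
  rewrite mul0r add0r; apply: eq_bigl => j.
  by rewrite -leqNgt ltn_neqAle -val_eqE /= andbC.
rewrite (eq_bigr _ (fun i _ => split3 i)) big_split /= mulr_natl mulr2n; congr (_ + _).
rewrite (exchange_big_dep xpredT) //=; apply: eq_bigr => i _; apply: eq_bigr => j _.
by rewrite sA sB mulrNN.
Qed.

Section Main.
Variables (F : finFieldType) (m : nat) (chi : 'CF([set: F])).
Let q : algC := #|F|%:R.
Hypothesis oddF : odd #|F|.
Hypothesis two_neq0 : 2%:R != 0 :> F.
Hypothesis chi_lin : chi \is a linear_char.
Hypothesis chi_neq1 : chi != 1.

(** The pairing of the Krawtchouk sums runs over the entries above the diagonal,
    which is half of the trace pairing (tr_skew). *)
Definition halved (x : F) : algC := chi (x / 2%:R).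

Lemma chiD : {morph (chi : F -> algC) : x y / x + y >-> x * y}.
Proof. by move=> x y; apply: (lin_charM chi_lin); rewrite inE. Qed.

Lemma chi0 : chi 0 = 1.
Proof. exact: (lin_char1 chi_lin). Qed.

Lemma chi_nontrivial : exists y, chi y != 1.
Proof.
apply/existsP; apply: contraNT chi_neq1; rewrite negb_exists => /forallP h.
by apply/eqP/cfunP => x; rewrite cfun1E inE; apply/eqP/negPn/h.
Qed.

Lemma halvedD : {morph halved : x y / x + y >-> x * y}.
Proof. by move=> x y; rewrite /halved mulrDl chiD. Qed.

Lemma halved0 : halved 0 = 1.
Proof. by rewrite /halved mul0r chi0. Qed.

Lemma halved_nontrivial : exists y, halved y != 1.
Proof.
have [y hy] := chi_nontrivial; exists (y * 2%:R).
by rewrite /halved mulfK.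
Qed.

Lemma skewrkP n s (A : 'M[F]_n) :
  (A \in skewrk F n s) = selfadj (-1) A && (\rank A == s.*2).
Proof. by rewrite inE /selfadj /= scaleN1r. Qed.

(** The sum takes the same value at all skew-symmetric matrices of rank [2s],
    because its generating function only depends on [s]. *)
Lemma krawtchoukE n (r s : nat) (J : 'M[F]_n) :
  selfadj (-1) J -> \rank J = s.*2 ->
  krawtchouk chi n r s = charsum halved (-1) J r.*2.
Proof.
move=> sJ rJ; rewrite /krawtchouk; case: leqP => r_n; last first.
  rewrite /charsum big_pred0 // => A; apply/negbTE; rewrite negb_and.
  apply/orP; right; rewrite neq_ltn; apply/orP; left.
  apply: leq_ltn_trans (rank_leq_row A) _.
  by move: r_n; clear; lia.
case: pickP => [A|/(_ J)]; last by rewrite skewrkP sJ rJ eqxx.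
rewrite skewrkP => /andP[sA /eqP rA].
rewrite (charsum_skew_eq two_neq0 halvedD halved0 halved_nontrivial _ sJ sA rJ rA).
rewrite /charsum; apply: eq_big => [B|B]; first by rewrite skewrkP.
rewrite skewrkP => /andP[sB _].
by rewrite /halved tr_skew // mulrC mulKf.
Qed.

Lemma weight_charsum (B : 'M[F]_m) r :
  (rweight B r)%:R = (q - 1) / q * ((musym F m r)%:R - charsum chi 1 B r).
Proof.
have q_neq0 : q != 0 by rewrite Num.Theory.pnatr_eq0 -lt0n; apply/card_gt0P; exists 0.
have symrkP (A : 'M[F]_m) : (A \in symrk F m r) = selfadj 1 A && (\rank A == r).
  by rewrite inE selfadj1P.
have trE (A : 'M[F]_m) : A \in symrk F m r -> \tr (B *m A^T) = \tr (B *m A).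
  by rewrite symrkP selfadj1P => /andP[/eqP-> _].
pose N := #|[set A in symrk F m r | \tr (B *m A) == 0]|.
have muE : (musym F m r)%:R = N%:R + (rweight B r)%:R :> algC.
  rewrite -natrD /musym /N /rweight; congr (_%:R).
  rewrite -(cardsID [set A | \tr (B *m A) == 0] (symrk F m r)).
  by congr addn; apply: eq_card => A; rewrite !inE // andbC.
have S_scale c : c != 0 ->
    \sum_(A in symrk F m r) chi (c * \tr (B *m A)) = charsum chi 1 B r.
  move=> c0; rewrite /charsum [RHS](reindex_inj (scalerI c0)) /=.
  apply: eq_big => [A|A AP].
    rewrite symrkP /selfadj /= !scale1r (eqmx_scale _ c0) linearZ /=.
    by rewrite (inj_eq (scalerI c0)).
  by rewrite linearZ /= -scalemxAr mxtraceZ trE.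
have qN : q * N%:R = (musym F m r)%:R + (q - 1) * charsum chi 1 B r.
  have -> : q * N%:R = \sum_(A in symrk F m r) \sum_c chi (c * \tr (B *m A)).
    under eq_bigr do rewrite (sum_char_scalar chiD chi0 chi_nontrivial).
    rewrite -big_mkcondr /= sumr_const -[RHS]mulr_natr; congr (_ * _%:R).
    by apply: eq_card => A; rewrite inE unfold_in.
  rewrite exchange_big (bigD1 0) //=; congr (_ + _).
    under eq_bigr do rewrite mul0r chi0.
    by rewrite sumr_const.
  rewrite (eq_bigr (fun=> charsum chi 1 B r)) => [|c c0]; last exact: S_scale.
  rewrite sumr_const -mulr_natl; congr (_ * _).
  rewrite /q -(cardC (pred1 (0 : F))) card1 natrD [RHS]addrC addKr.
  by congr (_%:R); apply: eq_card.
have -> : (rweight B r)%:R = (musym F m r)%:R - N%:R :> algC.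
  by rewrite muE addrAC subrr add0r.
apply: (mulfI q_neq0); rewrite mulrBr qN mulrA mulrCA divff // mulr1; ring.
Qed.

(** For [tau = 0] there may be no skew-symmetric matrix of rank [2l] and size
    [m - 2]; the empty matrix then takes its place, with coefficient 0. *)
Lemma charsum_symgf (B : 'M[F]_m) tau l :
  (l.*2 <= m - 1)%N -> (tau = 0 \/ (l.*2 <= m - 2)%N) ->
  (forall z, genfun 1 chi B z = symgf F tau l m z) ->
  forall r : nat,
  [/\ charsum chi 1 B r.*2.+1
        = - q ^+ r.*2 * krawtchouk chi (m - 1) r l
          + tau * q ^+ (m - l - 1) * q ^+ r.*2 * krawtchouk chi (m - 2) r l,
      charsum chi 1 B 0 = krawtchouk chi (m - 1) 0 l
    & charsum chi 1 B r.+1.*2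
        = q ^+ r.+1.*2 * krawtchouk chi (m - 1) r.+1 l
          - tau * q ^+ (m - l - 1) * q ^+ r.*2 * krawtchouk chi (m - 2) r l].
Proof.
move=> l_m tau_l eB r.
have [J sJ rJ] := skew_exists F l_m.
rewrite !(krawtchoukE _ sJ rJ).
have gf := genfun_skew two_neq0 halvedD halved0 halved_nontrivial.
have coefs := charsum_sym two_neq0 halvedD halved0 halved_nontrivial.
case: tau_l eB => [->|l_m2] eB.
  have s0 : selfadj (-1) (0 : 'M[F]_0) by rewrite /selfadj /= trmx0 scaler0.
  have r0 : \rank (0 : 'M[F]_0) = 0.*2 by rewrite mxrank0.
  rewrite !mul0r subr0 addr0.
  have [|-> -> ->] := coefs chi 0 _ _ _ B J 0 l 0 sJ s0 rJ r0 _ r.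
    by move=> z; rewrite eB /symgf (gf l _ _ _ sJ rJ) !mul0r.
  by rewrite !mul0r subr0 addr0.
have [J' sJ' rJ'] := skew_exists F l_m2.
rewrite !(krawtchoukE _ sJ' rJ').
apply: (coefs chi (tau * q ^+ (m - l - 1)) _ _ _ B J J' l l sJ sJ' rJ rJ' _ r).
by move=> z; rewrite eB /symgf (gf l _ _ _ sJ rJ) (gf l _ _ _ sJ' rJ').
Qed.

Lemma genfun_odd_rank (B : 'M[F]_m) l z : B^T = B -> \rank B = l.*2.+1 ->
  genfun 1 chi B z = symgf F 0 l m z.
Proof.
move=> tB rB.
rewrite (genfun_nonhyperbolic oddF two_neq0 chiD chi0 chi_nontrivial) ?rB //=;
  by rewrite odd_double //= doubleK.
Qed.

Lemma genfun_even_rank (B : 'M[F]_m) l z : B^T = B -> \rank B = l.+1.*2 ->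
  genfun 1 chi B z = symgf F (mxtype B)%:~R l m z.
Proof.
move=> tB rB; have eB : ~~ odd (\rank B) by rewrite rB odd_double.
rewrite /mxtype (negPf eB).
have := hyperbolicP two_neq0 tB eB; rewrite rB doubleK => hP.
case: hP => hB.
  by rewrite (genfun_hyperbolic two_neq0 chiD chi0 chi_nontrivial z tB rB hB).
rewrite (genfun_nonhyperbolic oddF two_neq0 chiD chi0 chi_nontrivial) ?rB ?doubleK //.
by rewrite odd_double /= uphalf_double.
Qed.

End Main.

Theorem proposition3p5 (p e : nat) (F : finFieldType) (m : nat)
    (chi : 'CF([set: F])) (q := #|F|%:R : algC) :
  prime p -> odd p -> #|F| = (p ^ e)%N -> (0 < m)%N ->
  chi \is a linear_char -> chi != 1 ->
  [/\ forall (r l : nat) (B : 'M[F]_m),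
        (r.*2.+1 <= m)%N -> (l.*2.+1 <= m)%N -> B \in symrk F m l.*2.+1 ->
        (rweight B r.*2.+1)%:R =
          (q - 1) / q * ((musym F m r.*2.+1)%:R
            + q ^+ r.*2 * krawtchouk chi (m - 1) r l),
      forall (r l : nat) (tau : int) (B : 'M[F]_m),
        (1 <= l)%N -> (r.*2.+1 <= m)%N -> (l.*2 <= m)%N ->
        tau = 1 \/ tau = -1 -> B \in symrk F m l.*2 -> mxtype B = tau ->
        (rweight B r.*2.+1)%:R =
          (q - 1) / q * ((musym F m r.*2.+1)%:R
            + q ^+ r.*2 * krawtchouk chi (m - 1) r (l - 1)
            - tau%:~R * q ^ (m%:Z - l%:Z + r.*2%:Z)
              * krawtchouk chi (m - 2) r (l - 1)),
      forall (r l : nat) (B : 'M[F]_m),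
        (r.*2 <= m)%N -> (l.*2.+1 <= m)%N -> B \in symrk F m l.*2.+1 ->
        (rweight B r.*2)%:R =
          (q - 1) / q * ((musym F m r.*2)%:R
            - q ^+ r.*2 * krawtchouk chi (m - 1) r l) &
      forall (r l : nat) (tau : int) (B : 'M[F]_m),
        (1 <= l)%N -> (r.*2 <= m)%N -> (l.*2 <= m)%N ->
        tau = 1 \/ tau = -1 -> B \in symrk F m l.*2 -> mxtype B = tau ->
        (rweight B r.*2)%:R =
          (q - 1) / q * ((musym F m r.*2)%:R
            - q ^+ r.*2 * krawtchouk chi (m - 1) r (l - 1)
            + tau%:~R * q ^ (m%:Z - l%:Z + r.*2%:Z - 2)
              * krawtchouk chi (m - 2) (r%:Z - 1) (l - 1))].
Proof.
move=> pp odd_p cardF m_gt0 chi_lin chi_neq1.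
have two_neq0 : 2%:R != 0 :> F.
  rewrite -(dvdn_pcharf (card_finPcharP cardF pp)) dvdn_prime2 //.
  by apply: contraTneq odd_p => ->.
have oddF : odd #|F| by rewrite cardF oddX odd_p orbT.
have weight := weight_charsum chi_lin chi_neq1.
split.
- move=> r l B _ l_m; rewrite inE => /andP[/eqP tB /eqP rB].
  rewrite weight.
  have [|||-> _ _] := charsum_symgf two_neq0 chi_lin chi_neq1
    (B := B) (tau := 0) (l := l) _ _ _ r.
  + by move: l_m; clear; lia.
  + by left.
  + by move=> z; apply: genfun_odd_rank.
  by rewrite !mul0r -/q; ring.
- move=> r [//|l] tau B _ _ l_m _; rewrite inE => /andP[/eqP tB /eqP rB] <-.
  rewrite weight subSS subn0.
  have [|||-> _ _] := charsum_symgf two_neq0 chi_lin chi_neq1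
    (B := B) (tau := (mxtype B)%:~R) (l := l) _ _ _ r.
  + by move: l_m; clear; lia.
  + by right; move: l_m; clear; lia.
  + by move=> z; apply: genfun_even_rank.
  have -> : m%:Z - l.+1%:Z + r.*2%:Z = (m - l - 1 + r.*2)%N%:Z.
    by move: l_m; clear; lia.
  by rewrite -exprnP exprD -/q; ring.
- move=> r l B _ l_m; rewrite inE => /andP[/eqP tB /eqP rB].
  have coefs := charsum_symgf two_neq0 chi_lin chi_neq1
    (B := B) (tau := 0) (l := l).
  rewrite weight; case: r => [|r].
    have [|||_ -> _] := coefs _ _ _ 0.
    + by move: l_m; clear; lia.
    + by left.
    + by move=> z; apply: genfun_odd_rank.
    by rewrite expr0 mul1r.
  have [|||_ _ ->] := coefs _ _ _ r.
  + by move: l_m; clear; lia.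
  + by left.
  + by move=> z; apply: genfun_odd_rank.
  by rewrite !mul0r subr0.
move=> r [//|l] tau B _ _ l_m _; rewrite inE => /andP[/eqP tB /eqP rB] <-.
have coefs := charsum_symgf two_neq0 chi_lin chi_neq1
    (B := B) (tau := (mxtype B)%:~R) (l := l).
rewrite weight subSS subn0; case: r => [|r].
  have [|||_ -> _] := coefs _ _ _ 0.
  + by move: l_m; clear; lia.
  + by right; move: l_m; clear; lia.
  + by move=> z; apply: genfun_even_rank.
  by rewrite expr0 mul1r sub0r /= mulr0 addr0.
have [|||_ _ ->] := coefs _ _ _ r.
+ by move: l_m; clear; lia.
+ by right; move: l_m; clear; lia.
+ by move=> z; apply: genfun_even_rank.
have -> : m%:Z - l.+1%:Z + r.+1.*2%:Z - 2 = (m - l - 1 + r.*2)%N%:Z.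
  by move: l_m; clear; lia.
have -> : r.+1%:Z - 1 = r by rewrite -addn1 PoszD addrK.
by rewrite -exprnP exprD -/q; ring.
Qed.
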